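(* There exists a constant $c>0$, depending only on the dimension $n$, such that for every rearrangement invariant space $X=X(Q_0)$, with representation space $\bar X$ on $(0,1)$, and for all $f\in GaRo_X(Q_0)$, $$\|f^*\|_{GaRo_{\bar X}(0,1)}\le c\,\|f\|_{GaRo_X(Q_0)}.$$
   Context: $Q_0\subset\mathbb R^n$ is a fixed cube with $|Q_0|=1$; all cubes have sides parallel to the coordinate axes. $f^*$ denotes the decreasing rearrangement of $|f|$, a function on $(0,1)$. Rearrangement invariant (r.i.) space $X$ on $Q_0$ (or on $(0,1)$): a Banach function space which is either separable or has the Fatou property ($0\le f_n\uparrow f\in X$ implies $\|f_n\|_X\uparrow\|f\|_X$), such that $g\in X$ and $f^*=g^*$ imply $f\in X$ and $\|f\|_X=\|g\|_X$. One has $L^\infty\subset X\subset L^1$ with continuous embeddings. Convention: $\|g\|_X=\infty$ if $g\notin X$. The representation space $\bar X=\bar X(0,1)$ is the unique r.i. space on $(0,1)$ with $\|f\|_X=\|f^*\|_{\bar X}$. Let $D$ be $Q_0$ (in dimension $n$) or the interval $(0,1)$ (in dimension $1$, where cubes are intervals), and let $Y$ be an r.i. space on $D$. $P(D)$ is the set of all countable (possibly finite) families $\{Q_i\}$ of subcubes of $D$ with pairwise disjoint interiors. For $f\in L^1(D)$, $\Gamma_f$ is the class of integrable functions $\gamma$ on $D$ such that for all $\{Q_i\}\in P(D)$ $$\sum_i\frac1{|Q_i|}\int_{Q_i}\int_{Q_i}|f(x)-f(y)|\,dx\,dy\le\sum_i\int_{Q_i}\gamma(x)\,dx .$$ $\|f\|_{GaRo_Y(D)}=\inf\{\|\gamma\|_Y:\gamma\in\Gamma_f\}$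 (equal to $\infty$ if $\Gamma_f=\varnothing$), and $GaRo_Y(D)=\{f\in L^1(D):\|f\|_{GaRo_Y(D)}<\infty\}$. *)

(* Defs.v *)
From HB Require Import structures.
From mathcomp Require Import all_boot all_order all_algebra.
From mathcomp Require Import all_classical all_reals all_analysis.

Set Implicit Arguments.
Unset Strict Implicit.
Unset Printing Implicit Defensive.

Import Order.TTheory GRing.Theory Num.Theory.
Import numFieldNormedType.Exports.

Local Open Scope classical_set_scope.
Local Open Scope ring_scope.

(* Lebesgue measure on R^n (Borel sigma-algebra of n.-tuple R), obtained by
   iterating the product with one-dimensional Lebesgue measure and carrying the
   result over to tuples along (x, t) |-> x :: t. *)
Section lebesgue_tuple.
Context {R : realType}.

Definition tcons n (p : measurableTypeR R * n.-tuple R) : n.+1.-tuple R :=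
  [tuple of p.1 :: p.2].

Lemma measurable_tcons n : measurable_fun setT (@tcons n).
Proof.
by apply: measurable_cons; [exact: measurable_fst|exact: measurable_snd].
Qed.

HB.instance Definition _ n :=
  isMeasurableFun.Build _ _ _ _ (@tcons n) (@measurable_tcons n).

Section step.
Variables (n : nat) (mu : {sigma_finite_measure set (n.-tuple R) -> \bar R}).

Definition lebesgue_tcons : set (n.+1.-tuple R) -> \bar R :=
  pushforward ((@lebesgue_measure R) \x mu)%E (@tcons n).

Let lebesgue_tcons0 : lebesgue_tcons set0 = 0%E.
Proof. exact: measure0. Qed.

Let lebesgue_tcons_ge0 A : (0 <= lebesgue_tcons A)%E.
Proof. exact: measure_ge0. Qed.

Let lebesgue_tcons_sigma_additive : semi_sigma_additive lebesgue_tcons.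
Proof. exact: measure_semi_sigma_additive. Qed.

HB.instance Definition _ := isMeasure.Build _ _ _ lebesgue_tcons
  lebesgue_tcons0 lebesgue_tcons_ge0 lebesgue_tcons_sigma_additive.

Lemma lebesgue_tcons_sigma_finite : sigma_finite setT lebesgue_tcons.
Proof.
have /sigma_finiteP[F [TF ndF Foo]] := sigma_finiteT (@lebesgue_measure R).
have /sigma_finiteP[G [TG ndG Goo]] := sigma_finiteT mu.
pose hd (t : n.+1.-tuple R) : measurableTypeR R := thead t.
pose tl (t : n.+1.-tuple R) : n.-tuple R := [tuple of behead t].
exists (fun k => (hd @^-1` F k) `&` (tl @^-1` G k)).
  apply/seteqP; split => // t _.
  have [k _ Fkt] : (\bigcup_k F k) (hd t) by rewrite -TF.
  have [l _ Glt] : (\bigcup_k G k) (tl t) by rewrite -TG.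
  exists (maxn k l) => //; split.
    by have /subsetPset := ndF _ _ (leq_maxl k l); exact.
  by have /subsetPset := ndG _ _ (leq_maxr k l); exact.
move=> k; have [mF Fk] := Foo k; have [mG Gk] := Goo k; split.
  apply: measurableI; rewrite -[X in measurable X]setTI.
    exact: (@measurable_tnth _ R n.+1 ord0).
  exact: measurable_behead.
rewrite /lebesgue_tcons /pushforward (_ : _ @^-1` _ = F k `*` G k).
  by rewrite product_measure1E// lte_mul_pinfty// ge0_fin_numE.
have tlK p : tl (tcons p) = p.2 by apply: val_inj.
by apply/seteqP; split => p /=; rewrite tlK /hd theadE.
Qed.

HB.instance Definition _ := Measure_isSigmaFinite.Build _ _ _
  lebesgue_tcons lebesgue_tcons_sigma_finite.

End step.

Fixpoint lebesgue_tuple n : {sigma_finite_measure set (n.-tuple R) -> \bar R} :=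
  if n is n'.+1 then lebesgue_tcons (lebesgue_tuple n') else \d_([tuple]).

Lemma lebesgue_tuple_box n (A : 'I_n -> set R) :
  (forall i, measurable (A i)) ->
  lebesgue_tuple n [set x | forall i, A i (tnth x i)] =
  (\prod_(i < n) lebesgue_measure (A i))%E.
Proof.
elim: n A => [|n IH] A mA.
  rewrite big_ord0 /= diracE mem_set//=.
  by case.
rewrite big_ord_recl /= /lebesgue_tcons /pushforward.
rewrite (_ : _ @^-1` _ =
  A ord0 `*` [set x : n.-tuple R | forall i, A (lift ord0 i) (tnth x i)]).
  rewrite product_measure1E; first by rewrite -IH.
    exact: (mA ord0).
  have -> : [set x : n.-tuple R | forall i, A (lift ord0 i) (tnth x i)] =
      \bigcap_(i in [set: 'I_n]) [set x | A (lift ord0 i) (tnth x i)].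
    by apply/seteqP; split => x /= H i => [_|]; exact: H.
  apply: fin_bigcap_measurable => // i _; rewrite -[X in measurable X]setTI.
  exact: (measurable_tnth i).
apply/seteqP; split => [[x t] /= H|[x t] /= [H0 H] i].
  by split => [|i]; [have := H ord0 | have := H (lift ord0 i); rewrite tnthS].
by have [j ->|->//] := unliftP ord0 i; rewrite tnthS.
Qed.

End lebesgue_tuple.

Section rearrangement_invariant.
Context {d : measure_display} {T : measurableType d} {R : realType}.
Variables (mu : {measure set T -> \bar R}) (D : set T).
Implicit Types f g : T -> R.

(* The decreasing rearrangement of |f|, f being considered on D only. *)
Definition rearr f (t : R) : R :=
  inf [set s | 0 <= s /\ (mu (D `&` [set x | (s < `|f x|)%R]) <= t%:E)%E].

(* Function spaces on D are given by their norm extended by +oo outside the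
   space, so that the space itself is [set f | N f < +oo].  Functions are
   total on T, but only their restriction to D up to null sets matters. *)
Section norms.
Variable N : (T -> R) -> \bar R.
Local Open Scope ereal_scope.

Record banach_function_norm : Prop := BanachFunctionNorm {
  bfn_ge0 : forall f, 0 <= N f ;
  bfn_measurable : forall f, N f < +oo -> measurable_fun D f ;
  bfn_eq0 : forall f, measurable_fun D f ->
    (N f = 0 <-> {ae mu, forall x, D x -> f x = 0%R}) ;
  bfnZ : forall (a : R) f, N f < +oo ->
    N (fun x => a * f x)%R = `|a|%:E * N f ;
  bfnD : forall f g, N f < +oo -> N g < +oo ->
    N (fun x => f x + g x)%R <= N f + N g ;
  bfn_ideal : forall f g, measurable_fun D f -> N g < +oo ->
    {ae mu, forall x, D x -> (`|f x| <= `|g x|)%R} -> N f <= N g ;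
  bfn_complete : forall u : nat -> T -> R, (forall k, N (u k) < +oo) ->
    (forall e : R, (0 < e)%R -> exists k0, forall k l, (k0 <= k)%N ->
       (k0 <= l)%N -> N (fun x => u k x - u l x)%R < e%:E) ->
    exists f, N f < +oo /\ N (fun x => u k x - f x)%R @[k --> \oo] --> 0 }.

Definition separable_norm : Prop :=
  exists s : nat -> T -> R, (forall k, N (s k) < +oo) /\
    forall f, N f < +oo -> forall e : R, (0 < e)%R ->
      exists k, N (fun x => f x - s k x)%R < e%:E.

Definition fatou_norm : Prop :=
  forall (u : nat -> T -> R) f, (forall k, measurable_fun D (u k)) ->
    {ae mu, forall x, D x -> (forall k, 0 <= u k x <= u k.+1 x)%R /\
                             u k x @[k --> \oo] --> f x} ->
    N f < +oo -> N (u k) @[k --> \oo] --> N f.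

End norms.

Record ri_space := RISpace {
  ri_norm :> (T -> R) -> \bar R ;
  ri_banach : banach_function_norm ri_norm ;
  ri_separable_or_fatou : separable_norm ri_norm \/ fatou_norm ri_norm ;
  ri_invariant : forall f g, measurable_fun D f -> (ri_norm g < +oo)%E ->
    (forall t, 0 < t < 1 -> rearr f t = rearr g t) -> ri_norm f = ri_norm g ;
  ri_Loo : exists C : R, forall f (M : R), measurable_fun D f ->
    {ae mu, forall x, D x -> `|f x| <= M} -> (ri_norm f <= (C * M)%:E)%E ;
  ri_L1 : exists C : R, forall f, (ri_norm f < +oo)%E ->
    (\int[mu]_(x in D) `|f x|%:E <= C%:E * ri_norm f)%E }.

End rearrangement_invariant.

(* The definition is uniform in the ambient space: [cube] singles out the
   cubes of T and [int] is the interior operator of T. *)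
Section garsia_rodemich.
Context {d : measure_display} {T : measurableType d} {R : realType}.
Variables (mu : {measure set T -> \bar R}) (cube : set (set T)).
Variables (int : set T -> set T) (D : set T).
Implicit Types f g : T -> R.
Local Open Scope ereal_scope.

(* The family {Q i | P i}; P may hold for finitely many i only. *)
Definition packing (P : pred nat) (Q : nat -> set T) : Prop :=
  (forall i, P i -> cube (Q i) /\ Q i `<=` D) /\
  (forall i j, P i -> P j -> i != j -> int (Q i) `&` int (Q j) = set0).

Definition Gamma f : set (T -> R) := [set g |
  mu.-integrable D (EFin \o g) /\
  forall P Q, packing P Q ->
    \sum_(i <oo | P i) ((fine (mu (Q i)))^-1%:E *
      \int[mu]_(x in Q i) \int[mu]_(y in Q i) `|f x - f y|%:E)
    <= \sum_(i <oo | P i) \int[mu]_(x in Q i) (g x)%:E].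

Definition GaRo_norm (N : (T -> R) -> \bar R) f : \bar R :=
  ereal_inf (N @` Gamma f).

Definition GaRo (N : (T -> R) -> \bar R) : set (T -> R) := [set f |
  mu.-integrable D (EFin \o f) /\ GaRo_norm N f < +oo].

End garsia_rodemich.

(* Cubes may be open, closed, or contain part of their boundary. *)
Section cubes.
Context {R : realType}.

Definition cube1 : set (set R) := [set Q | exists (a h : R) (b b' : bool),
  0 < h /\ Q = [set` Interval (BSide b a) (BSide b' (a + h))]].

Definition cube n : set (set (n.-tuple R)) := [set Q |
  exists (a : n.-tuple R) (h : R) (b b' : 'I_n -> bool), 0 < h /\
    Q = [set x | forall i, tnth x i \in
           Interval (BSide (b i) (tnth a i)) (BSide (b' i) (tnth a i + h))]].

(* The interior of A in R^n (n.-tuple R carries no topology in the library). *)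
Definition interior_tuple n (A : set (n.-tuple R)) : set (n.-tuple R) :=
  [set x | exists2 e : R, 0 < e &
    forall y : n.-tuple R, (forall i, `|tnth x i - tnth y i| < e) -> A y].

Definition unit_itv : set R := `]0, 1[.

Definition GaRo_normQ n (Q0 : set (n.-tuple R)) :=
  GaRo_norm (lebesgue_tuple n) (@cube n) (@interior_tuple n) Q0.

Definition GaRoQ n (Q0 : set (n.-tuple R)) :=
  GaRo (lebesgue_tuple n) (@cube n) (@interior_tuple n) Q0.

Definition GaRo_norm01 :=
  GaRo_norm (@lebesgue_measure R) cube1 (@interior R) unit_itv.

Definition representation_space n (Q0 : set (n.-tuple R))
    (X : ri_space (lebesgue_tuple n) Q0)
    (Xbar : ri_space (@lebesgue_measure R) unit_itv) : Prop :=
  forall f, measurable_fun Q0 f -> X f = Xbar (rearr (lebesgue_tuple n) Q0 f).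

End cubes.

(* Main.v *)
Require Import Defs.
From HB Require Import structures.
From mathcomp Require Import all_boot all_order all_algebra.
From mathcomp Require Import all_classical all_reals all_analysis.
From mathcomp Require Import measurable_realfun lra.

Set Implicit Arguments.
Unset Strict Implicit.
Unset Printing Implicit Defensive.

Import Order.TTheory GRing.Theory Num.Theory.
Import numFieldNormedType.Exports.

Local Open Scope classical_set_scope.
Local Open Scope ring_scope.

(* Let h be the rearrangement of f, and let g satisfy the Garsia-Rodemich
   condition for f.  It is enough to find v on (0, 1) whose distribution function
   is at most that of g and such that
     |I|^-1 \int_I \int_I |h x - h y| <= c \int_I v   for every interval I;
   then v is bounded in norm by g in any rearrangement invariant space.

   By bisection it suffices to have |L| (h l - h r) <= c \int_L v for the dyadic
   intervals L = (l, r) that touch neither 0 nor 1.  Group them into the blocks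
   J_k = (2^-(k+2), 2^-(k+1)) and their mirror images.  The stopping cubes of the
   level sets E_k = {|f| > h (2^-(k+1))} form nested sets O_k with |O_k| <= C |E_k|
   and, by the condition on g,
     \int_(O_k) |g| >= 1/2 \int_(E_k) (|f| - h (2^-(k+1))),
   the right-hand side being at least the total demand of the blocks J_k, J_(k+1),
   etc.  Serving the outer demands from the innermost available mass yields disjoint
   A_k inside O_k with \int_(A_k) |g| >= c |J_k| (h (2^-(k+2)) - h (2^-(k+1))).
   Finally every dyadic L inside J_k receives a copy of g restricted to A_k,
   dilated by the factor |L| (h l - h r) / (C |J_k| (h (2^-(k+2)) - h (2^-(k+1)))):
   these factors sum up to at most 2/C over all L inside J_k. *)

(** * Distribution functions and rearrangements *)

(** The obstacle is that g controls the oscillation of f on cubes of the given domain, which bear no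
    relation to the intervals on which h oscillates. Level sets of |f| are what both sides share,
    and there the mass of g may be spent only once, although the sets O_k are nested and all deeper
    levels draw on the same mass. The allocation works because the mass on O_k covers the demands of
    all blocks from k on, and because |g| dx has no atoms, so that a set of any prescribed mass can
    be cut out. The mirror blocks come from the same argument with -|f| in place of |f|: what
    matters is a function G with |G x - G y| <= |f x - f y|. Constants: the density threshold
    2^-(n+1) of the stopping cubes leads to C = 2^(n+2), and c = 2^(n+5) is 8 C. One factor 2 undoes
    the 1/2 in the lower bound for the integral of |g|, one is lost in bisecting intervals, and one
    in passing from the oscillation around a constant to the double integral. *)

Section layer_cake.
Context {d : measure_display} {T : measurableType d} {R : realType}.
Variable mu : {sigma_finite_measure set T -> \bar R}.
Local Open Scope ereal_scope.

(** The distribution function of |g| on A. *)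
Definition tail (A : set T) (g : T -> R) (s : R) : \bar R :=
  mu (A `&` [set x | (s < `|g x|)%R]).

Variables (A : set T) (g : T -> R).
Hypotheses (mA : measurable A) (mg : measurable_fun A g).

(** g is extended by zero off A. As the upper inequality is strict, the added points belong to no
    section at a level s >= 0. *)
Let hypograph : set (T * measurableTypeR R) :=
  [set p | (0 <= p.2 < `|(g \_ A) p.1|)%R].

Let measurable_hypograph : measurable hypograph.
Proof.
have mgA : measurable_fun setT (fun p : T * measurableTypeR R => `|(g \_ A) p.1|%R).
  apply: measurableT_comp => //; apply: measurableT_comp => //.
  exact/(measurable_restrictT g mA).1.
rewrite (_ : hypograph = (fun p : T * measurableTypeR R => (0 <= p.2)%R) @^-1` [set true]
   `&` (fun p : T * measurableTypeR R => (p.2 < `|(g \_ A) p.1|)%R) @^-1` [set true]); last first.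
  by apply/seteqP; split => p /= /andP.
apply: measurableI; rewrite -[X in measurable X]setTI.
  by apply: (measurable_fun_ler (f := cst 0%R) (g := snd)).
by apply: (measurable_fun_ltr (f := snd)).
Qed.

Let ysection_hypograph (s : R) : (0 <= s)%R ->
  mu (ysection hypograph s) = tail A g s.
Proof.
move=> s0; congr (mu _); apply/seteqP; split => x; rewrite /ysection/= inE /hypograph/= /patch.
  by rewrite s0/=; case: ifPn => [/set_mem ? //|_]; rewrite normr0 ltNge s0.
by move=> [/mem_set -> ->]; rewrite s0.
Qed.

Lemma measurable_tail : measurable_fun (`[0%R, +oo[%classic : set R) (tail A g).
Proof.
apply: (eq_measurable_fun (mu \o ysection hypograph)) => [s|].
  by rewrite inE/= in_itv/= andbT => s0; rewrite ysection_hypograph.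
by apply: measurable_funTS; exact: measurable_fun_ysection.
Qed.

Lemma layer_cake :
  \int[mu]_(x in A) `|g x|%:E = \int[lebesgue_measure]_(s in `[0%R, +oo[) tail A g s.
Proof.
transitivity (\int[mu]_x (lebesgue_measure (xsection hypograph x))).
  rewrite integral_mkcond; apply: eq_integral => x _.
  rewrite (_ : xsection hypograph x = `[0%R, `|(g \_ A) x|%R[%classic); last first.
    by apply/seteqP; split => s; rewrite /xsection/= inE /hypograph/= in_itv.
  rewrite lebesgue_measure_itv/= /patch; case: ifPn => xA; last by rewrite normr0 ltxx.
  rewrite lte_fin normr_gt0; case: eqP => [->|]; first by rewrite normr0.
  by rewrite oppr0 adde0.
have := indic_fubini_tonelli mu (@lebesgue_measure R) measurable_hypograph.
rewrite indic_fubini_tonelli_FE ?indic_fubini_tonelli_GE//= => ->.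
rewrite [RHS]integral_mkcond; apply: eq_integral => s _.
rewrite /patch; case: ifPn => [/set_mem|/negP s0].
  by rewrite /= in_itv/= andbT; exact: ysection_hypograph.
rewrite (_ : ysection _ _ = set0) ?measure0//; apply/seteqP; split => // x.
by rewrite /ysection/= inE /hypograph/= => /andP[s0' _]; apply: s0; rewrite inE/= in_itv/= andbT.
Qed.

End layer_cake.

Section spread.
Context {R : realType}.
Local Open Scope ereal_scope.
Implicit Type m : R -> \bar R.

(* The decreasing function of [x - l] whose distribution function is [m]. *)
Definition spread (l : R) m (x : R) : \bar R :=
  lebesgue_measure [set s : R | (0 <= s)%R /\ (x - l)%:E < m s].

Variables (l : R) (m : R -> \bar R).
Hypothesis mm : measurable_fun (`[0%R, +oo[%classic : set R) m.

Lemma spread_ge0 x : 0 <= spread l m x.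
Proof. exact: measure_ge0. Qed.

Let region : set (measurableTypeR R * measurableTypeR R) :=
  [set p | (0 <= p.2)%R /\ (p.1 - l)%:E < m p.2].

Let measurable_region : measurable region.
Proof.
have m0 : measurable_fun setT (m \_ (`[0%R, +oo[%classic : set R)).
  exact: (measurable_restrictT m (measurable_itv `[0%R, +oo[)).1.
rewrite (_ : region = (fun p : measurableTypeR R * measurableTypeR R => (0 <= p.2)%R) @^-1` [set true]
   `&` ((fun p : measurableTypeR R * measurableTypeR R =>
           (p.1 - l)%:E < (m \_ (`[0%R, +oo[%classic : set R)) p.2) @^-1` [set true])); last first.
  apply/seteqP; split => p /=; rewrite /patch.
    by move=> [p0]; rewrite mem_set//= in_itv/= andbT.
  by move=> [p0]; rewrite mem_set//= in_itv/= andbT.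
apply: measurableI; rewrite -[X in measurable X]setTI.
  by apply: (measurable_fun_ler (f := cst 0%R) (g := snd)).
apply: (measurable_fun_lte (f := fun p : measurableTypeR R * measurableTypeR R => (p.1 - l)%:E)) => //.
  by apply/measurable_EFinP; apply: measurable_funB.
exact: (measurableT_comp m0).
Qed.

Lemma measurable_spread : measurable_fun setT (spread l m).
Proof.
apply: (eq_measurable_fun (lebesgue_measure \o xsection region)) => [x _|].
  rewrite /spread /=; congr lebesgue_measure.
  by apply/seteqP; split => s; rewrite /xsection/= inE.
exact: measurable_fun_xsection.
Qed.

(** If m s <= x - l, monotonicity confines all levels t with x - l < m t to [0, s[, so [spread] is
    at most s at x. *)
Lemma spread_gt (s x : R) : {in `[0%R, +oo[ &, {homo m : a b / (a <= b)%R >-> b <= a}} ->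
  (0 <= s)%R -> s%:E < spread l m x -> (x - l)%:E < m s.
Proof.
move=> nm s0; rewrite ltNge => sx; rewrite ltNge; apply: contra sx => ms.
rewrite (_ : s%:E = lebesgue_measure `[0%R, s[%classic); last first.
  rewrite lebesgue_measure_itv/= lte_fin; case: ltP => [_|s0']; first by rewrite oppr0 adde0.
  by apply/eqP; rewrite eqe eq_le s0 s0'.
apply: le_measure.
- rewrite inE; have := measurable_xsection x measurable_region.
  by congr measurable; apply/seteqP; split => t; rewrite /xsection/= inE.
- by rewrite inE.
- move=> t [t0 xt]; rewrite /= in_itv/= t0/= ltNge; apply/negP => st.
  have := lt_le_trans xt (nm s t _ _ st); rewrite !in_itv/= !andbT ltNge ms.
  by move=> /(_ s0 t0).
Qed.

(** Tonelli: at height s the region under the graph has the section ]l, l + m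
    s[, which the bound on m keeps inside ]l, r[. *)
Lemma integral_spread (r : R) : (forall s, (0 <= s)%R -> 0 <= m s <= (r - l)%:E) ->
  \int[lebesgue_measure]_(x in `]l, r[) spread l m x =
  \int[lebesgue_measure]_(s in `[0%R, +oo[) m s.
Proof.
move=> mr; pose E := region `&` (`]l, r[%classic `*` setT).
have mE : measurable E.
  by apply: measurableI => //; apply: measurableX => //; exact: measurable_itv.
transitivity (\int[lebesgue_measure]_x (lebesgue_measure (xsection E x))).
  rewrite integral_mkcond; apply: eq_integral => x _.
  rewrite /patch; case: ifPn => xA.
    congr (lebesgue_measure _); apply/seteqP; split => s; rewrite /xsection/= inE /E/=.
      by move=> ?; split => //; split => //; exact: set_mem.
    by move=> -[].
  rewrite (_ : xsection _ _ = set0) ?measure0//; apply/seteqP; split => // s.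
  by rewrite /xsection/= inE => -[_ [xlr _]]; move/negP: xA; apply; rewrite inE.
have := indic_fubini_tonelli (@lebesgue_measure R) (@lebesgue_measure R) mE.
rewrite indic_fubini_tonelli_FE ?indic_fubini_tonelli_GE//= => ->.
rewrite [RHS]integral_mkcond; apply: eq_integral => s _.
rewrite /patch; case: ifPn => [/set_mem|/negP s0].
  rewrite /= in_itv/= andbT => s0.
  have /andP[] := mr _ s0; case ms : (m s) => [z| |]//; rewrite !lee_fin => z0 zr.
  rewrite (_ : ysection E s = `]l, (l + z)%R[%classic).
    rewrite lebesgue_measure_itv/= lte_fin ltrDl; case: ltP => z0'.
      by rewrite -EFinB addrAC subrr add0r.
    by congr EFin; apply/eqP; rewrite eq_le z0 z0'.
  apply/seteqP; split => x; rewrite /ysection/= inE /E /region/= ms lte_fin !in_itv/=.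
    by move=> [[_ ?] [/andP[-> _] _]]/=; rewrite -ltrBlDl.
  move=> /andP[lx xz]; rewrite lx/=; split; first by split=> //; rewrite ltrBlDl.
  by split => //; rewrite (lt_le_trans xz)// -lerBrDl.
rewrite (_ : ysection _ _ = set0) ?measure0//; apply/seteqP; split => // x.
rewrite /ysection/= inE /E/= => -[[s0' _] _]; apply: s0.
by rewrite inE/= in_itv/= andbT.
Qed.

End spread.

Section rearrangement.
Context {d : measure_display} {T : measurableType d} {R : realType}.
Variables (mu : {sigma_finite_measure set T -> \bar R}) (D : set T) (g : T -> R).
Hypotheses (mD : measurable D) (Doo : (mu D < +oo)%E) (mg : measurable_fun D g).

Lemma measurable_superlevel (s : R) : measurable (D `&` [set x | s < `|g x|]).
Proof.
have mgn : measurable_fun D (fun x => `|g x|) by exact: measurableT_comp.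
have := measurable_fun_ltr (measurable_cst s) mgn.
by move=> /(_ mD [set true]); apply.
Qed.

Lemma tail_le (s t : R) : s <= t -> (tail mu D g t <= tail mu D g s)%E.
Proof.
move=> st; apply: le_measure; rewrite ?inE; try exact: measurable_superlevel.
by move=> x [Dx /= tx]; split => //=; exact: le_lt_trans tx.
Qed.

Lemma tail_fin (s : R) : tail mu D g s \is a fin_num.
Proof.
rewrite ge0_fin_numE; last exact: measure_ge0.
apply: le_lt_trans Doo; apply: le_measure; rewrite ?inE//.
exact: measurable_superlevel.
Qed.

Lemma tail_right_continuous (s : R) :
  tail mu D g (s + n.+1%:R^-1) @[n --> \oo] --> tail mu D g s.
Proof.
rewrite /tail (_ : D `&` [set x | s < `|g x|] =
  \bigcup_n (D `&` [set x | s + n.+1%:R^-1 < `|g x|])); last first.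
  apply/seteqP; split => x /=.
    move=> [Dx sx]; have : 0 < `|g x| - s by rewrite subr_gt0.
    move=> /ltr_add_invr[k]; rewrite add0r => sk; exists k => //; split => //=.
    by rewrite addrC -ltrBrDr.
  move=> [k _ [Dx /= sx]]; split => //; apply: le_lt_trans sx.
  by rewrite lerDl.
apply: nondecreasing_cvg_mu.
- by move=> k; exact: measurable_superlevel.
- by apply: bigcupT_measurable => k; exact: measurable_superlevel.
- apply/nondecreasing_seqP => k; apply/subsetPset => x [Dx /= sx]; split => //=.
  by apply: le_lt_trans sx; rewrite lerD2l lef_pV2// ?posrE// ler_nat.
Qed.

Lemma tail_cvg0 : tail mu D g n%:R @[n --> \oo] --> 0%E.
Proof.
rewrite /tail -(measure0 mu) (_ : set0 =
  \bigcap_n (D `&` [set x | n%:R < `|g x|])); last first.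
  apply/seteqP; split => // x /= H.
  have [_ /=] := H (Num.truncn `|g x|).+1 I.
  by rewrite ltNge ltW// truncnS_gt.
apply: nonincreasing_cvg_mu.
- apply: le_lt_trans Doo; apply: le_measure; rewrite ?inE//.
  exact: measurable_superlevel.
- by move=> k; exact: measurable_superlevel.
- by apply: bigcapT_measurable => k; exact: measurable_superlevel.
- apply/nonincreasing_seqP => k; apply/subsetPset => x [Dx /= sx]; split => //=.
  by apply: le_lt_trans sx; rewrite ler_nat.
Qed.

Let E (t : R) := [set s : R | 0 <= s /\ (tail mu D g s <= t%:E)%E].

Lemma rearr_has_inf (t : R) : 0 < t -> has_inf (E t).
Proof.
move=> t0; split; last by exists 0 => s [].
have /fine_cvgP[_] := tail_cvg0.
move=> /cvgr_lt/(_ t)/=/(_ t0)[k _ Hk]; exists k%:R; split => //=.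
rewrite -(fineK (tail_fin _)) lee_fin ltW//.
by apply: Hk => /=.
Qed.

(** A tail that exceeds t at s still exceeds it slightly to the right of s, which keeps the infimum
    defining [rearr] above s. The equivalence turns questions about rearrangements into questions
    about tails. *)
Lemma rearr_gt (t s : R) : 0 < t -> 0 <= s ->
  (s < rearr mu D g t) = (t%:E < tail mu D g s)%E.
Proof.
move=> t0 s0; apply/idP/idP; last first.
  move=> ts; rewrite ltNge; apply/negP => rs.
  have := tail_right_continuous (s := s).
  rewrite -[X in _ --> X](fineK (tail_fin s)) => /fine_cvgP[_].
  have : t < fine (tail mu D g s) by rewrite -lte_fin fineK// tail_fin.
  move=> ts' /cvgr_gt/(_ _ ts')[k _ /(_ k (leqnn _))/=].
  have : inf (E t) < s + k.+1%:R^-1 by apply: le_lt_trans rs _; rewrite ltrDl.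
  move=> /(inf_lt (rearr_has_inf t0).1)[u [u0 ut] us].
  rewrite ltNge -lee_fin fineK ?tail_fin// => /negP; apply.
  by apply: le_trans ut; apply: tail_le; exact: ltW.
apply: contraTT; rewrite -leNgt => ts; rewrite -leNgt.
apply: ge_inf; first by exists 0 => u [].
by split.
Qed.

Lemma rearr_ge0 t : 0 <= rearr mu D g t.
Proof.
change (0 <= inf (E t)).
(* For t <= 0 the set may be empty, and its infimum is then 0 by convention. *)
have [->|/set0P E0] := eqVneq (E t) set0; first by rewrite inf0.
by apply: lb_le_inf => // s [].
Qed.

Lemma rearr_le (t u : R) : 0 < t -> t <= u -> rearr mu D g u <= rearr mu D g t.
Proof.
move=> t0 tu; rewrite leNgt; apply/negP => tr.
have := tr; rewrite rearr_gt ?rearr_ge0//; last exact: lt_le_trans tu.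
move=> ut; have : rearr mu D g t < rearr mu D g t.
  rewrite [ltRHS]/rearr.
  rewrite (rearr_gt t0) ?rearr_ge0//.
  by apply: le_lt_trans ut; rewrite lee_fin.
by rewrite ltxx.
Qed.

End rearrangement.

Section rearrangement_unit.
Context {d : measure_display} {T : measurableType d} {R : realType}.
Variables (mu : {sigma_finite_measure set T -> \bar R}) (D : set T) (g : T -> R).
Hypotheses (mD : measurable D) (Doo : (mu D < +oo)%E) (mg : measurable_fun D g).

Let h := rearr mu D g.

Lemma measurable_rearr (A : set R) : measurable A -> A `<=` [set x | 0 < x] ->
  measurable_fun A h.
Proof.
move=> mA A0; apply: (measurability _ (RGenOInfty.measurableE R)) => //.
move=> _ [_ [s ->] <-]; have [s0|s0] := leP 0 s.
  rewrite (_ : A `&` _ = A `&` `]-oo, fine (tail mu D g s)[%classic).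
    by apply: measurableI => //; exact: measurable_itv.
  apply/seteqP; split => t [At] /=; rewrite !in_itv/= ?andbT => th; split => //.
    by move: th; rewrite (rearr_gt mD Doo mg (A0 _ At) s0) -lte_fin fineK ?tail_fin.
  rewrite (rearr_gt mD Doo mg (A0 _ At) s0).
  by rewrite -[ltRHS]fineK ?lte_fin// tail_fin.
rewrite (_ : A `&` _ = A)//; apply/seteqP; split => [t []//|t At]; split => //=.
by rewrite in_itv/= andbT (lt_le_trans s0)// rearr_ge0.
Qed.

(** By [rearr_gt] the superlevel set of the rearrangement is an initial interval whose length is the
    tail of g. It fits into (0, 1) because D has measure at most 1. *)
Lemma tail_rearr (s : R) : (mu D <= 1)%E -> 0 <= s ->
  tail (@lebesgue_measure R) unit_itv h s = tail mu D g s.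
Proof.
move=> D1 s0.
have t1 : (tail mu D g s <= 1)%E.
  by apply: le_trans D1; apply: le_measure; rewrite ?inE//; exact: measurable_superlevel.
rewrite {1}/tail (_ : _ `&` _ = `]0, fine (tail mu D g s)[%classic).
  transitivity (lebesgue_measure (`]0, fine (tail mu D g s)[%classic : set R)) => //.
  rewrite lebesgue_measure_itv/= lte_fin; case: ltP => [t0|].
    by rewrite oppr0 adde0 fineK// tail_fin.
  rewrite -lee_fin fineK ?tail_fin// => t0.
  by apply/eqP; rewrite eq_le t0 measure_ge0.
apply/seteqP; split => t /=; rewrite /unit_itv/= !in_itv/=.
  move=> [/andP[t0 t1']]; rewrite ger0_norm ?rearr_ge0// t0/=.
  by rewrite (rearr_gt mD Doo mg t0 s0) -lte_fin fineK// tail_fin.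
move=> /andP[t0 tt]; rewrite t0 ger0_norm ?rearr_ge0//=; split.
  by rewrite (lt_le_trans tt)// -lee_fin fineK ?tail_fin.
by rewrite (rearr_gt mD Doo mg t0 s0) -[ltRHS]fineK ?lte_fin// tail_fin.
Qed.

End rearrangement_unit.

Lemma eq_rearr {d : measure_display} {T : measurableType d} {R : realType}
    {d' : measure_display} {T' : measurableType d'}
    (mu : {sigma_finite_measure set T -> \bar R}) (D : set T) (g : T -> R)
    (mu' : {sigma_finite_measure set T' -> \bar R}) (D' : set T') (g' : T' -> R) t :
  (forall s, 0 <= s -> tail mu D g s = tail mu' D' g' s) ->
  rearr mu D g t = rearr mu' D' g' t.
Proof.
move=> H; congr inf; apply/seteqP; split => s [s0 /= st]; split => //=.
  by have := H s s0; rewrite /tail => <-.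
by have := H s s0; rewrite /tail => ->.
Qed.

Lemma le_rearr {d : measure_display} {T : measurableType d} {R : realType}
    {d' : measure_display} {T' : measurableType d'}
    (mu : {sigma_finite_measure set T -> \bar R}) (D : set T) (g : T -> R)
    (mu' : {sigma_finite_measure set T' -> \bar R}) (D' : set T') (g' : T' -> R) (t : R) :
  measurable D -> (mu D < +oo)%E -> measurable_fun D g ->
  measurable D' -> (mu' D' < +oo)%E -> measurable_fun D' g' ->
  (forall s, 0 <= s -> (tail mu' D' g' s <= tail mu D g s)%E) -> 0 < t ->
  rearr mu' D' g' t <= rearr mu D g t.
Proof.
move=> mD Doo mg mD' Doo' mg' H t0; rewrite leNgt; apply/negP => tr.
have := tr; rewrite (rearr_gt mD' Doo' mg') ?rearr_ge0// => ut.
suff : rearr mu D g t < rearr mu D g t by rewrite ltxx.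
rewrite (rearr_gt mD Doo mg) ?rearr_ge0//.
by apply: lt_le_trans ut _; apply: H; exact: rearr_ge0.
Qed.

Lemma unit_itv_gt0 {R : realType} : @unit_itv R `<=` [set x | 0 < x].
Proof. by move=> x; rewrite /unit_itv/= in_itv/= => /andP[]. Qed.

Lemma measurable_unit_itv {R : realType} : measurable (@unit_itv R).
Proof. exact: measurable_itv. Qed.

Lemma lebesgue_unit_itv {R : realType} : lebesgue_measure (@unit_itv R) = 1%E.
Proof. by rewrite lebesgue_measure_itv/= lte_fin ltr01 oppr0 adde0. Qed.

(** Invariance replaces g' by its own rearrangement. Smaller tails make this lie pointwise below the
    rearrangement of g, and the ideal property compares the norms. *)
Lemma ri_norm_le_tail {d : measure_display} {T : measurableType d} {R : realType}
    (mu : {sigma_finite_measure set T -> \bar R}) (D : set T) (g : T -> R)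
    (X : ri_space (@lebesgue_measure R) unit_itv) (g' : R -> R) :
  measurable D -> (mu D <= 1)%E -> measurable_fun D g -> measurable_fun unit_itv g' ->
  (forall s, 0 <= s -> (tail (@lebesgue_measure R) unit_itv g' s <= tail mu D g s)%E) ->
  (X (rearr mu D g) < +oo)%E -> (X g' <= X (rearr mu D g))%E.
Proof.
move=> mD D1 mg mg' H Xg.
have Doo : (mu D < +oo)%E by rewrite (le_lt_trans D1)// ltry.
have Uoo : (lebesgue_measure (@unit_itv R) < +oo)%E by rewrite lebesgue_unit_itv ltry.
have mr := measurable_rearr (mu := @lebesgue_measure R) measurable_unit_itv Uoo mg' measurable_unit_itv unit_itv_gt0.
have Xr : (X (rearr lebesgue_measure unit_itv g') <= X (rearr mu D g))%E.
  apply: (bfn_ideal (ri_banach X)) => //.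
  apply: aeW => t /unit_itv_gt0 t0; rewrite !ger0_norm ?rearr_ge0//.
  by apply: le_rearr => //; exact: measurable_unit_itv.
have -> : X g' = X (rearr lebesgue_measure unit_itv g') => //.
apply: ri_invariant => //; first exact: le_lt_trans Xg.
move=> t _; apply: eq_rearr => s s0; rewrite tail_rearr//.
- exact: measurable_unit_itv.
- by rewrite (_ : _ unit_itv = 1%E)//; exact: lebesgue_unit_itv.
Qed.

(** * Dyadic cubes *)

Lemma prode_const {R : realType} n (r : R) : (\prod_(j < n) r%:E = (r ^+ n)%:E)%E.
Proof. by elim: n => [|n IH]; rewrite ?big_ord0// big_ord_recl IH exprS EFinM. Qed.

Lemma pow_half_small {R : realType} (e : R) : 0 < e ->
  exists N, forall M, (N <= M)%N -> 2 ^- M < e.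
Proof.
move=> e0; have h1 : `|2^-1 : R| < 1 by rewrite ger0_norm ?invr_ge0// invf_lt1 ?ltr1n.
have /cvgr_lt/(_ _ e0)[N _ HN] := cvg_expr h1.
by exists N => M /HN /=; rewrite exprVn.
Qed.

Section dyadic_cubes.
Context {R : realType}.
Variables (n : nat) (a : n.-tuple R).
Implicit Types (N : nat) (i : n.-tuple nat) (x : n.-tuple R).

Definition unit_box : set (n.-tuple R) :=
  [set x | forall j, tnth x j \in `[tnth a j, tnth a j + 1[].

Definition corner N i : n.-tuple R :=
  [tuple tnth a j + (tnth i j)%:R * 2 ^- N | j < n].

Definition dyadic_box (b b' : bool) N i : set (n.-tuple R) :=
  [set x | forall j, tnth x j \in Interval (BSide b (tnth (corner N i) j))
                                     (BSide b' (tnth (corner N i) j + 2 ^- N))].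

(** Two kinds of dyadic cubes are used. Half-open ones partition [unit_box], so that a point has one
    address in each generation. Open ones lie in [Q0] whatever part of its boundary [Q0] contains,
    so that the condition on g can be tested on them. *)
Definition hcube := dyadic_box true true.
Definition ocube := dyadic_box false true.

Definition valid N i := forall j, (tnth i j < 2 ^ N)%N.

Definition address N x : n.-tuple nat :=
  [tuple Num.truncn (2 ^+ N * (tnth x j - tnth a j)) | j < n].

Definition coarsen i : n.-tuple nat := [tuple (tnth i j)./2 | j < n].

Let two_gt0 N : 0 < 2 ^- N :> R. Proof. by rewrite invr_gt0 exprn_gt0. Qed.

Lemma measurable_dyadic_box b b' N i : measurable (dyadic_box b b' N i).
Proof.
rewrite (_ : dyadic_box _ _ _ _ = \bigcap_(j in [set: 'I_n])
  ([set: n.-tuple R] `&` (fun x : n.-tuple R => tnth x j) @^-1`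
    [set` Interval (BSide b (tnth (corner N i) j)) (BSide b' (tnth (corner N i) j + 2 ^- N))])).
  apply: fin_bigcap_measurable => // j _.
  by apply: (@measurable_tnth _ R n j) => //; exact: measurable_itv.
by apply/seteqP; split => x /= H j => [_|]; [split => //; exact: H | case: (H j I)].
Qed.

Lemma lebesgue_dyadic_box b b' N i :
  lebesgue_tuple n (dyadic_box b b' N i) = ((2 ^- N) ^+ n)%:E.
Proof.
have := @lebesgue_tuple_box R n (fun j =>
  [set` Interval (BSide b (tnth (corner N i) j)) (BSide b' (tnth (corner N i) j + 2 ^- N))])
  (fun j => measurable_itv _).
rewrite (eq_bigr (fun=> (2 ^- N)%:E)) => [|j _]; last first.
  rewrite lebesgue_measure_itv/= lte_fin ltrDl two_gt0.
  by rewrite -EFinB addrAC subrr add0r.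
by rewrite prode_const => <-.
Qed.

Lemma ocube_hcube N i : ocube N i `<=` hcube N i.
Proof.
move=> x xi j; have := xi j; rewrite !in_itv/= => /andP[/ltW -> ->]//.
Qed.

Lemma hcube_address N i x : hcube N i x -> address N x = i.
Proof.
move=> xi; apply: eq_from_tnth => j; rewrite tnth_mktuple; apply: truncn_def.
have := xi j; rewrite in_itv/= tnth_mktuple => /andP[xl xr].
have N0 : 0 < 2 ^+ N :> R by rewrite exprn_gt0.
have NN : 2 ^+ N * 2 ^- N = 1 :> R by rewrite divff// gt_eqF.
apply/andP; split.
  rewrite -(ler_pM2r (two_gt0 N)) mulrAC NN mul1r.
  by rewrite lerBrDl.
rewrite -(ltr_pM2r (two_gt0 N)) mulrAC NN mul1r.
by rewrite ltrBlDl -natr1 mulrDl mul1r addrA.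
Qed.

Lemma mem_hcube_address N x : (forall j, tnth a j <= tnth x j) -> hcube N (address N x) x.
Proof.
move=> ax j; rewrite in_itv/= !tnth_mktuple.
have N0 : 0 < 2 ^+ N :> R by rewrite exprn_gt0.
have NN : 2 ^+ N * 2 ^- N = 1 :> R by rewrite divff// gt_eqF.
have : 0 <= 2 ^+ N * (tnth x j - tnth a j) by rewrite mulr_ge0 ?subr_ge0// ltW.
move=> /truncn_itv/andP[]; set k := Num.truncn _ => kl kr.
apply/andP; split.
  by move: kl; rewrite -(ler_pM2r (two_gt0 N)) mulrAC NN mul1r lerBrDl.
move: kr; rewrite -(ltr_pM2r (two_gt0 N)) mulrAC NN mul1r -natr1 mulrDl mul1r.
by rewrite ltrBlDl addrA.
Qed.

Lemma unit_box_ge x : unit_box x -> forall j, tnth a j <= tnth x j.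
Proof. by move=> xu j; have := xu j; rewrite in_itv/= => /andP[]. Qed.

Lemma valid_address N x : unit_box x -> valid N (address N x).
Proof.
move=> xu j; rewrite tnth_mktuple.
have := xu j; rewrite in_itv/= => /andP[xl xr].
rewrite -(ltr_nat R) natrX.
have x0 : 0 <= tnth x j - tnth a j by rewrite subr_ge0.
have N0 : 0 < 2 ^+ N :> R by rewrite exprn_gt0.
have /andP[+ _] := truncn_itv (mulr_ge0 (ltW N0) x0).
move=> /le_lt_trans; apply.
by rewrite gtr_pMr// ltrBlDl.
Qed.

Lemma hcube_unit_box N i : valid N i -> hcube N i `<=` unit_box.
Proof.
move=> vi x xi j; have := xi j; rewrite !in_itv/= tnth_mktuple => /andP[xl xr].
apply/andP; split; first by rewrite (le_trans _ xl)// lerDl mulr_ge0// ltW.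
rewrite (lt_le_trans xr)// -addrA lerD2l -[X in _ + X]mul1r -mulrDl natr1.
by rewrite ler_pdivrMr ?exprn_gt0// mul1r -natrX ler_nat.
Qed.

Lemma ocube_parent N i : ocube N.+1 i `<=` ocube N (coarsen i).
Proof.
move=> x xi j; have := xi j; rewrite !in_itv/= !tnth_mktuple => /andP[xl xr].
have e2 : 2 ^- N = 2 * 2 ^- N.+1 :> R.
  by rewrite exprS invfM mulrA divff ?mul1r// pnatr_eq0.
have := odd_double_half (tnth i j); set q := (tnth i j)./2 => iq.
have iR : (tnth i j)%:R = (odd (tnth i j))%:R + 2 * q%:R :> R.
  by rewrite -[in LHS]iq natrD -mul2n natrM.
have p0 := two_gt0 N.+1.
move: xl xr; rewrite iR e2; set p := 2 ^- N.+1 in p0 *; set c := tnth a j; set y := tnth x j.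
case: (odd _) => /= xl xr; nra.
Qed.

Lemma valid_coarsen N i : valid N.+1 i -> valid N (coarsen i).
Proof.
move=> vi j; rewrite tnth_mktuple; have := vi j.
by rewrite expnS mul2n ltn_half_double.
Qed.

Lemma address_coarsen N x : (forall j, tnth a j <= tnth x j) ->
  coarsen (address N.+1 x) = address N x.
Proof.
move=> ax; apply/esym/eq_from_tnth => j; rewrite !tnth_mktuple; apply: truncn_def.
have := ax j; rewrite -subr_ge0; set y := _ - _ => y0.
have : 0 <= 2 ^+ N.+1 * y by rewrite mulr_ge0// exprn_ge0.
move=> /truncn_itv; set k := Num.truncn _; rewrite exprS -mulrA; set z := 2 ^+ N * y.
have := odd_double_half k; set q := k./2 => kq.
have kR : k%:R = (odd k)%:R + 2 * q%:R :> R.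
  by rewrite -[in LHS]kq natrD -mul2n natrM.
by rewrite -!natr1 kR; case: (odd k) => /= /andP[? ?]; apply/andP; split; lra.
Qed.

Lemma ocube_disjoint N i i' x : ocube N i x -> ocube N i' x -> i = i'.
Proof.
by move=> /ocube_hcube/hcube_address <- /ocube_hcube/hcube_address.
Qed.

Lemma ocube_ancestor M N i : (M <= N)%N -> valid N i ->
  exists2 i', valid M i' & ocube N i `<=` ocube M i'.
Proof.
move=> MN; rewrite -(subnK MN); elim: (N - M)%N i => [|k IH] i vi; first by exists i.
have [i' vi' ii'] := IH _ (valid_coarsen vi).
by exists i' => //; apply: subset_trans ii'; exact: ocube_parent.
Qed.

Lemma ocube_nested M N i i' x : (M <= N)%N -> valid N i ->
  ocube N i x -> ocube M i' x -> ocube N i `<=` ocube M i'.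
Proof.
move=> MN vi xi xi'; have [i'' _ ii''] := ocube_ancestor MN vi.
by rewrite (ocube_disjoint xi' (ii'' _ xi)).
Qed.

Lemma measurable_hcube N i : measurable (hcube N i).
Proof. exact: measurable_dyadic_box. Qed.

Lemma measurable_ocube N i : measurable (ocube N i).
Proof. exact: measurable_dyadic_box. Qed.

Lemma unit_boxE : unit_box = hcube 0 [tuple 0%N | j < n].
Proof.
by apply/seteqP; split => x H j; have := H j; rewrite !in_itv/= !tnth_mktuple expr0 invr1 mul0r addr0.
Qed.

Lemma measurable_unit_box : measurable unit_box.
Proof. by rewrite unit_boxE; exact: measurable_hcube. Qed.

Lemma lebesgue_unit_box : lebesgue_tuple n unit_box = 1%E.
Proof. by rewrite unit_boxE lebesgue_dyadic_box expr0 invr1 expr1n. Qed.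

End dyadic_cubes.

(** * A weak density theorem by dyadic approximation *)

Section density.
Context {R : realType}.
Variables (n : nat) (a : n.-tuple R).
Let mu := @lebesgue_tuple R n.

Lemma address_iter_coarsen k N (x : n.-tuple R) : (forall j, tnth a j <= tnth x j) ->
  iter k (@coarsen n) (address a (k + N) x) = address a N x.
Proof.
by move=> ax; elim: k => [//|k IH]; rewrite addSn iterSr address_coarsen.
Qed.

(** Outside a small set W, membership in B is decided by the address in a single generation. This
    form is stable under complements and countable unions, which is how all measurable sets are
    reached. *)
Definition dyadic_approx (B : set (n.-tuple R)) := forall e : R, 0 < e ->
  exists N (I : set (n.-tuple nat)) (W : set (n.-tuple R)),
    [/\ measurable W, (mu W <= e%:E)%E &
     forall x, unit_box a x -> ~ W x -> (B x <-> I (address a N x))].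

(** Finitely many generations can be replaced by the finest one, because an address determines all
    coarser ones. The remaining sets of the union add little measure by continuity from above. *)
Lemma dyadic_approx_bigcup (F : nat -> set (n.-tuple R)) :
  (forall k, measurable (F k)) -> (forall k, dyadic_approx (F k)) ->
  dyadic_approx (\bigcup_k F k).
Proof.
move=> mF aF e e0.
have e20 : 0 < e / 2 by rewrite divr_gt0.
have /choice[p Hp] : forall k, exists p : nat * set (n.-tuple nat) * set (n.-tuple R),
    [/\ measurable p.2, (mu p.2 <= (e / 2 / (2 ^ k.+1)%:R)%:E)%E &
     forall x, unit_box a x -> ~ p.2 x -> (F k x <-> p.1.2 (address a p.1.1 x))].
  move=> k; have ek : 0 < e / 2 / (2 ^ k.+1)%:R by rewrite divr_gt0// ltr0n expn_gt0.
  by have [N [I [W H]]] := aF k _ ek; exists (N, I, W).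
(* Half of the budget e pays for the exceptional sets of all F k, the other half for V K, the part
   of the union missed by the first K sets. *)
pose V K := unit_box a `&` (\bigcup_k F k `\` \bigcup_(k < K) F k).
have mV K : measurable (V K).
  apply: measurableI; first exact: measurable_unit_box.
  by apply: measurableD; [exact: bigcupT_measurable | exact: bigcup_measurable].
have : mu (V K) @[K --> \oo] --> mu (\bigcap_K V K).
  apply: nonincreasing_cvg_mu => //.
  - apply: le_lt_trans (ltry 1); rewrite -(lebesgue_unit_box a).
    apply: le_measure; rewrite ?inE//; first exact: measurable_unit_box.
    by move=> x [].
  - exact: bigcapT_measurable.
  - apply/nonincreasing_seqP => K; apply/subsetPset => x [xu [Fx nFx]]; split => //.
    split => // -[k /= kK Fkx]; apply: nFx; exists k => //=.
    exact: ltn_trans kK _.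
rewrite (_ : \bigcap_K V K = set0) ?measure0; last first.
  apply/seteqP; split => // x xV; have [_ [[k _ Fkx] _]] := xV 0%N I.
  by have [_ [_]] := xV k.+1 I; apply; exists k => //=.
move=> /fine_cvgP[_ /cvgr_lt/(_ _ e20)[K _ /(_ K (leqnn _))/= VK]].
have VKe : (mu (V K) <= (e / 2)%:E)%E.
  rewrite -[leLHS]fineK ?lee_fin ?ltW// ge0_fin_numE ?measure_ge0//.
  apply: le_lt_trans (ltry 1); rewrite -(lebesgue_unit_box a).
  by apply: le_measure; rewrite ?inE//; [exact: measurable_unit_box | move=> x []].
pose N := (\max_(k < K) (p k).1.1)%N.
have Nk (k : nat) : (k < K)%N -> ((p k).1.1 <= N)%N.
  by move=> kK; exact: (leq_bigmax (Ordinal kK)).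
exists N, [set i | exists k, (k < K)%N /\ (p k).1.2 (iter (N - (p k).1.1) (@coarsen n) i)].
exists (\bigcup_k (p k).2 `|` V K).
have mp : measurable (\bigcup_k (p k).2).
  by apply: bigcupT_measurable => k; case: (Hp k).
split.
- exact: measurableU.
- apply: (le_trans (measureU2 _ _ _)) => //.
  rewrite [e in leRHS](_ : e = e / 2 + e / 2)%R; last by rewrite -splitr.
  rewrite EFinD leeD//.
  apply: (@le_trans _ _ (\sum_(k <oo) mu (p k).2)%E).
    by apply: generalized_Boole_inequality => // k; case: (Hp k).
  apply: le_trans (epsilon_trick0 xpredT (ltW e20)).
  by apply: lee_nneseries => // k _; case: (Hp k).
- move=> x xu nW; have ax := unit_box_ge xu.
  have np k : ~ (p k).2 x by move=> pkx; apply: nW; left; exists k.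
  split => [[k _ Fkx]|[k [kK Ik]]].
    have [l lK Flx] : (\bigcup_(k < K) F k) x.
      apply: contrapT => nFK; apply: nW; right; split => //; split => //.
      by exists k.
    exists l; split => //.
    have [_ _ /(_ x xu (np l))[+ _]] := Hp l; move=> /(_ Flx).
    by rewrite -{1}(address_iter_coarsen (N - (p l).1.1) _ ax) subnK// Nk.
  exists k => //; have [_ _ /(_ x xu (np k))[_]] := Hp k; apply.
  by rewrite -(address_iter_coarsen (N - (p k).1.1) _ ax) subnK// Nk.
Qed.

Lemma dyadic_approxC B : dyadic_approx B -> dyadic_approx (~` B).
Proof.
move=> aB e e0; have [N [I [W [mW We WB]]]] := aB e e0.
by exists N, (~` I), W; split => // x xu nW; have := WB x xu nW; rewrite /setC/=; tauto.
Qed.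

Lemma dyadic_approx0 : dyadic_approx set0.
Proof.
by move=> e e0; exists 0%N, set0, set0; split => //; rewrite measure0 lee_fin ltW.
Qed.

(** The lower corner of the cube of x decides, except when coordinate j of x is within 2^-N of c.
    That slab has measure at most 2 * 2^-N. *)
Lemma dyadic_approx_halfspace (j : 'I_n) (c : R) :
  dyadic_approx [set x | c < tnth x j].
Proof.
move=> e e0.
have [N Ne] : exists N, 2 * 2 ^- N < e :> R.
  have e20 : 0 < e / 2 by rewrite divr_gt0.
  have [N /(_ N (leqnn _))] := pow_half_small e20.
  by rewrite ltr_pdivlMr// mulrC => ?; exists N.
have p0 : 0 < 2 ^- N :> R by rewrite invr_gt0 exprn_gt0.
pose A (k : 'I_n) : set R := if k == j then `[c - 2 ^- N, c + 2 ^- N]%classic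
  else `[tnth a k, tnth a k + 1]%classic.
have mA k : measurable (A k) by rewrite /A; case: ifP => _; exact: measurable_itv.
exists N, [set i | c < tnth (corner a N i) j], [set x | forall k, A k (tnth x k)].
split.
- rewrite (_ : [set x | _] = \bigcap_(k in [set: 'I_n])
    ([set: n.-tuple R] `&` (fun x : n.-tuple R => tnth x k) @^-1` A k)).
    apply: fin_bigcap_measurable => // k _.
    by apply: (@measurable_tnth _ R n k).
  by apply/seteqP; split => x /= H k => [_|]; [split => //; exact: H | case: (H k I)].
- rewrite lebesgue_tuple_box// (bigD1 j)//= big1 => [|k kj].
    rewrite mule1 /A eqxx lebesgue_measure_itv/= lte_fin.
    case: ifP => _; last by rewrite lee_fin ltW.
    by rewrite -EFinB lee_fin; apply: ltW; apply: le_lt_trans Ne; lra.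
  by rewrite /A (negbTE kj) lebesgue_measure_itv/= lte_fin ltrDl ltr01 -EFinB addrAC subrr add0r.
- move=> x xu nW; have := mem_hcube_address N (unit_box_ge xu) j.
  rewrite in_itv/=; set y := tnth (corner _ _ _) j => /andP[yx xy]; split => cx.
    rewrite ltNge; apply/negP => yc; apply: nW => k.
    rewrite /A; case: eqP => [->|_]; rewrite /= in_itv/=.
      by apply/andP; split; [rewrite lerBlDr (le_trans (ltW cx))// lerDl ltW|rewrite (le_trans (ltW xy))// lerD2r].
    by have := xu k; rewrite in_itv/= => /andP[-> /ltW].
  exact: lt_le_trans yx.
Qed.

Let approximable := [set B | measurable B /\ dyadic_approx B].

Let sigma_algebra_approximable : sigma_algebra setT approximable.
Proof.
split.
- by split => //; exact: dyadic_approx0.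
- by move=> B [mB aB]; rewrite setTD; split; [exact: measurableC | exact: dyadic_approxC].
- move=> F FA; split; first by apply: bigcupT_measurable => k; have [] := FA k.
  by apply: dyadic_approx_bigcup => k; have [] := FA k.
Qed.

(** The approximable measurable sets form a sigma-algebra. It suffices that it contains the
    preimages of rays under coordinates, as these generate the measurable sets of tuples. *)
Lemma measurable_dyadic_approx B : measurable B -> dyadic_approx B.
Proof.
move=> mB; suff [] : approximable B by [].
move: B mB; apply: smallest_sub => //.
apply: (big_ind (fun X => X `<=` approximable)) => //.
- by move=> X Y XA YA B [/XA|/YA].
move=> j _ B [S mS <-]; rewrite setTI.
pose C := [set S : set R | approximable ((fun x : n.-tuple R => tnth x j) @^-1` S)].
have mS' : (@RGenOInfty.G R).-sigma.-measurable S by rewrite -RGenOInfty.measurableE.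
suff GC : (@RGenOInfty.G R).-sigma.-measurable `<=` C by exact: GC.
apply: smallest_sub => [|{mS mS'}S [c ->]].
  have [A0 AC AU] := sigma_algebra_approximable; split.
  - by rewrite /C/= preimage_set0.
  - by move=> A /AC; rewrite /C/= !setTD preimage_setC.
  - by move=> A /AU; rewrite /C/= preimage_bigcup.
split.
  rewrite -[X in measurable X]setTI; apply: (@measurable_tnth _ R n j) => //.
rewrite (_ : _ @^-1` _ = [set x | c < tnth x j]); first exact: dyadic_approx_halfspace.
by apply/seteqP; split => x /=; rewrite in_itv/= andbT.
Qed.

(* A weak Lebesgue density theorem: Z is compared with a union of dyadic cubes
   of one generation that approximates it in measure. *)
Lemma dyadic_density_null (Z : set (n.-tuple R)) (r : R) :
  measurable Z -> Z `<=` unit_box a -> 0 <= r < 1 ->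
  (forall N i, valid N i ->
    (mu (Z `&` hcube a N i) <= r%:E * mu (hcube a N i))%E) -> mu Z = 0%E.
Proof.
move=> mZ Zu /andP[r0 r1] Zr.
have fin_sub A : measurable A -> A `<=` unit_box a -> mu A \is a fin_num.
  move=> mA Au; rewrite ge0_fin_numE ?measure_ge0//.
  apply: le_lt_trans (ltry 1); rewrite -(lebesgue_unit_box a).
  by apply: le_measure; rewrite ?inE//; exact: measurable_unit_box.
apply/eqP; rewrite eq_le measure_ge0 andbT leNgt; apply/negP => Z0.
have [z zE] : exists z : R, mu Z = z%:E by exists (fine (mu Z)); rewrite fineK// fin_sub.
move: Z0; rewrite zE lte_fin => z0.
(* With u the measure of the approximating union, z <= r u + e and u <= z + e give (1 - r) z <= 2 e,
   which this choice of e contradicts. *)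
have e0 : 0 < (1 - r) * z / 4 by rewrite divr_gt0// mulr_gt0// subr_gt0.
have [N [I [W [mW We WZ]]]] := measurable_dyadic_approx mZ e0.
set e := (1 - r) * z / 4 in e0 We.
(* The approximating cubes, listed by the codes of their indices so that countable additivity
   applies. *)
pose F (k : nat) : set (n.-tuple R) := if pickle_inv k is Some i then
  if `[< I i /\ valid N i >] then hcube a N i else set0 else set0.
have FP k x : F k x -> exists i : n.-tuple nat,
    [/\ pickle_inv k = Some i, I i, valid N i & F k = hcube a N i].
  rewrite /F; case: pickle_inv => // i; case: asboolP => // -[Ii vi] _.
  by exists i.
have mF k : measurable (F k).
  rewrite /F; case: pickle_inv => // i; case: asboolP => // _.
  exact: measurable_hcube.
have tF : trivIset setT F.
  move=> k l _ _ [x [Fk Fl]].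
  have [i [ki _ _ Fi]] := FP _ _ Fk; have [i' [li _ _ Fi']] := FP _ _ Fl.
  move: Fk Fl; rewrite Fi Fi' => /hcube_address ix /hcube_address i'x.
  have := pickle_invK (T := n.-tuple nat) k; have := pickle_invK (T := n.-tuple nat) l.
  by rewrite ki li/= -ix -i'x => <- <-.
pose U := \bigcup_k F k.
have mU : measurable U by exact: bigcupT_measurable.
have Uu : U `<=` unit_box a.
  by move=> x [k _ Fk]; have [i [_ _ vi Fi]] := FP _ _ Fk; move: Fk; rewrite Fi; exact: hcube_unit_box.
have UP x : unit_box a x -> U x <-> I (address a N x).
  move=> xu; split => [[k _ Fk]|Ix].
    by have [i [_ Ii _ Fi]] := FP _ _ Fk; move: Fk; rewrite Fi => /hcube_address ->.
  exists (pickle (address a N x)) => //; rewrite /F pickleK_inv.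
  case: asboolP => [_|]; first exact: mem_hcube_address (unit_box_ge xu).
  by case; split => //; exact: valid_address.
have ZU : (mu (Z `&` U) <= r%:E * mu U)%E.
  rewrite /U setI_bigcupr measure_semi_bigcup; last 3 first.
    by move=> k; exact: measurableI.
    exact: trivIset_setIl.
    by apply: bigcupT_measurable => k; exact: measurableI.
  rewrite measure_semi_bigcup// -nneseriesZl//.
  apply: lee_nneseries => // k _; rewrite /F; case: pickle_inv => [i|].
    case: asboolP => [[_ vi]|_]; first exact: Zr.
    by rewrite setI0 measure0 mule0.
  by rewrite setI0 measure0 mule0.
have [u uE] : exists u : R, mu U = u%:E by exists (fine (mu U)); rewrite fineK// fin_sub.
have h1 : (mu Z <= mu (Z `&` U) + mu W)%E.
  apply: le_trans (measureU2 _ _ _) => //; last exact: measurableI.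
  apply: le_measure; rewrite ?inE//; first by apply: measurableU => //; exact: measurableI.
  move=> x Zx; have [Wx|nWx] := pselect (W x); first by right.
  by left; split => //; apply/UP; [exact: Zu|apply/WZ => //; exact: Zu].
have h2 : (mu U <= mu Z + mu W)%E.
  apply: le_trans (measureU2 _ _ _) => //.
  apply: le_measure; rewrite ?inE//; first exact: measurableU.
  move=> x Ux; have [Wx|nWx] := pselect (W x); first by right.
  by left; apply/WZ => //; [exact: Uu|apply/UP => //; exact: Uu].
have h3 : z <= r * u + e.
  rewrite -lee_fin -zE EFinD EFinM -uE; apply: le_trans h1 _.
  exact: leeD.
have h4 : u <= z + e.
  by rewrite -lee_fin -uE EFinD -zE; apply: le_trans h2 _; exact: leeD.
have h5 : r * u <= r * (z + e) by exact: ler_wpM2l.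
have h6 : r * e <= e by rewrite -[leRHS]mul1r ler_wpM2r ?ltW.
have h7 : (1 - r) * z = 4 * e by rewrite /e; lra.
by move: h3 h5 h7; rewrite mulrDr mulrBl mul1r; lra.
Qed.

End density.

(** * Calderon-Zygmund decomposition *)

Section nonmeasurable_integral.
Context {d : measure_display} {T : measurableType d} {R : realType}.
Variable mu : {measure set T -> \bar R}.
Local Open Scope ereal_scope.

(* The integral of a nonnegative function is a supremum over simple functions,
   hence monotone even where measurability is unknown. *)
Lemma le_integral_subset (A B : set T) (f g : T -> \bar R) :
  A `<=` B -> (forall x, A x -> 0 <= f x <= g x) -> (forall x, B x -> 0 <= g x) ->
  \int[mu]_(x in A) f x <= \int[mu]_(x in B) g x.
Proof.
move=> AB fg g0.
have f0 x : A x -> 0 <= f x by move=> /fg/andP[].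
rewrite (ge0_integralE _ f0) (ge0_integralE _ g0).
apply: le_ereal_sup => _ [h hf <-]; exists h => // x.
apply: (le_trans (hf x)); rewrite /patch; case: ifPn => [/set_mem Ax|_].
  by rewrite mem_set; [have /andP[] := fg _ Ax|exact: AB].
by case: ifPn => // /set_mem/g0.
Qed.

End nonmeasurable_integral.

Section calderon_zygmund.
Context {R : realType}.
Variables (n : nat) (a : n.-tuple R) (E : set (n.-tuple R)).
Let mu := @lebesgue_tuple R n.
Hypotheses (mE : measurable E) (E2 : (mu E <= (2^-1)%:E)%E).
Local Open Scope ereal_scope.

(** The density threshold 2^-(n+1) is chosen so that a cube with a light parent is at most half
    filled by E: passing to the parent multiplies the volume by 2^n. *)
Definition heavy N i :=
  valid N i /\ (2 ^- n.+1 * (2 ^- N) ^+ n)%:E < mu (E `&` ocube a N i).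

(** The union runs over all heavy cubes and not over the maximal ones, which makes it evidently
    monotone in E. Both unions agree by [heavy_selected]. *)
Definition heavy_set : set (n.-tuple R) :=
  [set x | exists N i, heavy N i /\ ocube a N i x].

Definition selected N i :=
  heavy N i /\ forall M i', (M < N)%N -> ocube a N i `<=` ocube a M i' -> ~ heavy M i'.

Lemma heavy_selected N i : heavy N i ->
  exists M i', selected M i' /\ ocube a N i `<=` ocube a M i'.
Proof.
move: i; elim/ltn_ind: N => N IH i hi.
have [si|] := pselect (selected N i); first by exists N, i; split.
move=> /not_andP[//|/existsNP[M /existsNP[i' /not_implyP[MN /not_implyP[ii' /contrapT hi']]]]].
have [M' [i'' [s'' i'i'']]] := IH M MN i' hi'.
by exists M', i''; split => //; exact: subset_trans i'i''.
Qed.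

(** The parent of a maximal heavy cube is light. In generation 0 there is no parent, and the
    hypothesis on the measure of E takes its place. *)
Lemma selected_half N i : selected N i ->
  mu (E `&` ocube a N i) <= (2^-1 * (2 ^- N) ^+ n)%:E.
Proof.
move=> [[vi hi] si]; case: N => [|N] in i vi hi si *.
  rewrite expr0 invr1 expr1n mulr1; apply: le_trans E2.
  by apply: le_measure; rewrite ?inE//; apply: measurableI => //; exact: measurable_ocube.
have := si N (coarsen i) (ltnSn _) (@ocube_parent _ _ a N i) => /not_andP[].
  by move=> []; exact: valid_coarsen.
move=> /negP; rewrite -leNgt => le; apply: le_trans (le_trans _ le) _.
  apply: le_measure; rewrite ?inE; [| |by apply: setIS; exact: ocube_parent].
  - by apply: measurableI => //; exact: measurable_ocube.
  - by apply: measurableI => //; exact: measurable_ocube.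
rewrite lee_fin [(2 ^- N.+1)%R](_ : _ = 2^-1 * 2 ^- N)%R; last by rewrite exprS invfM.
by rewrite exprMn [(2^-1 ^+ n)%R]exprVn mulrA exprS invfM.
Qed.

(** A packing is indexed by natural numbers, so k encodes a generation together with an index.
    [cz_pred] keeps the codes of selected cubes, and [cz_cell] puts the empty set at all other
    codes. *)
Definition cz_cube (k : nat) : set (n.-tuple R) :=
  if pickle_inv k is Some p then ocube a p.1 p.2 else set0.

Definition cz_pred : pred nat := fun k => `[< exists p : nat * n.-tuple nat,
  pickle_inv k = Some p /\ selected p.1 p.2 >].

Definition cz_cell k := if cz_pred k then cz_cube k else set0.

Lemma cz_predP k : cz_pred k -> exists p : nat * n.-tuple nat,
  [/\ pickle_inv k = Some p, selected p.1 p.2 & cz_cube k = ocube a p.1 p.2].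
Proof. by move=> /asboolP[p [kp sp]]; exists p; split => //; rewrite /cz_cube kp. Qed.

(** Dyadic cubes that meet are nested, and a selected cube lies in no heavy cube of an earlier
    generation. *)
Lemma cz_cube_disjoint k l : cz_pred k -> cz_pred l -> cz_cube k `&` cz_cube l !=set0 -> k = l.
Proof.
move=> /cz_predP[p [kp sp ->]] /cz_predP[q [lq sq ->]].
wlog pq : k l p q kp lq sp sq / (p.1 <= q.1)%N.
  move=> H; have [/H|/ltnW/H] := leqP p.1 q.1; first exact.
  by rewrite setIC => H' /(H' l k lq kp sq sp).
move=> [x [px qx]].
have qp := ocube_nested pq sq.1.1 qx px.
have [pqlt|] := ltnP p.1 q.1; first by have := sq.2 _ _ pqlt qp; case; exact: sp.1.
move=> qple; have e1 : p.1 = q.1 by apply/eqP; rewrite eqn_leq pq qple.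
have e2 : p.2 = q.2 by move: px; rewrite e1 => /ocube_disjoint/(_ qx).
have pqE : p = q by rewrite (surjective_pairing p) e1 e2 -surjective_pairing.
have := pickle_invK (T := (nat * n.-tuple nat)%type) k.
have := pickle_invK (T := (nat * n.-tuple nat)%type) l.
by rewrite kp lq/= pqE => <- <-.
Qed.

Lemma measurable_cz_cube k : measurable (cz_cube k).
Proof. by rewrite /cz_cube; case: pickle_inv => // p; exact: measurable_ocube. Qed.

Lemma measurable_cz_cell k : measurable (cz_cell k).
Proof. by rewrite /cz_cell; case: ifP => // _; exact: measurable_cz_cube. Qed.

Lemma trivIset_cz_cell : trivIset setT cz_cell.
Proof.
move=> k l _ _; rewrite /cz_cell.
case: ifPn => [pk|_]; last by rewrite set0I => /set0P; rewrite eqxx.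
case: ifPn => [pl|_]; last by rewrite setI0 => /set0P; rewrite eqxx.
exact: cz_cube_disjoint.
Qed.

Lemma heavy_setE : heavy_set = \bigcup_k cz_cell k.
Proof.
apply/seteqP; split => x.
  move=> [N [i [/heavy_selected[M [i' [si' ii']]] /ii' xi']]].
  exists (pickle (M, i')) => //; rewrite /cz_cell.
  have -> : cz_pred (pickle (M, i')) by apply/asboolP; exists (M, i'); rewrite pickleK_inv.
  by rewrite /cz_cube pickleK_inv.
move=> [k _]; rewrite /cz_cell; case: ifPn => // /cz_predP[p [_ sp ->]] xp.
by exists p.1, p.2; split => //; exact: sp.1.
Qed.

Lemma measurable_heavy_set : measurable heavy_set.
Proof. by rewrite heavy_setE; apply: bigcupT_measurable => k; exact: measurable_cz_cell. Qed.

(** Each selected cube Q satisfies |Q| < 2^(n+1) |E [&] Q|, and these cubes are disjoint. *)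
Lemma lebesgue_heavy_set : mu heavy_set <= (2 ^+ n.+1)%:E * mu E.
Proof.
rewrite heavy_setE measure_semi_bigcup//; last 3 first.
- exact: measurable_cz_cell.
- exact: trivIset_cz_cell.
- by rewrite -heavy_setE; exact: measurable_heavy_set.
apply: (@le_trans _ _ (\sum_(k <oo) ((2 ^+ n.+1)%:E * mu (E `&` cz_cell k)))).
  apply: lee_nneseries => // k _; rewrite /cz_cell; case: ifPn => [|_]; last first.
    by rewrite setI0 !measure0 mule0.
  move=> /cz_predP[p [_ [[_ hp] _] ->]].
  apply: (@le_trans _ _ ((2 ^- p.1) ^+ n)%:E).
    by have /eqP := lebesgue_dyadic_box a false true p.1 p.2; rewrite eq_le => /andP[].
  move/ltW: hp; rewrite -(@lee_pmul2l _ (2 ^+ n.+1)%:E) ?lte_fin ?exprn_gt0//.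
  by rewrite -EFinM mulrA divff ?mul1r// expf_neq0// pnatr_eq0.
rewrite nneseriesZl// lee_pmul2l ?lte_fin ?exprn_gt0//.
rewrite -measure_semi_bigcup//.
- rewrite -setI_bigcupr -heavy_setE; apply: le_measure; rewrite ?inE//.
  by apply: measurableI => //; exact: measurable_heavy_set.
- by move=> k; apply: measurableI => //; exact: measurable_cz_cell.
- by apply: trivIset_setIl; exact: trivIset_cz_cell.
- by apply: bigcupT_measurable => k; apply: measurableI => //; exact: measurable_cz_cell.
Qed.

(** The uncovered part of E misses every heavy cube and has density at most 2^-(n+1) < 1 in every
    light one, so [dyadic_density_null] applies. *)
Lemma heavy_set_covers : mu ((E `&` unit_box a) `\` heavy_set) = 0.
Proof.
have mZ : measurable ((E `&` unit_box a) `\` heavy_set).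
  apply: measurableD; last exact: measurable_heavy_set.
  by apply: measurableI => //; exact: measurable_unit_box.
apply: (@dyadic_density_null R n a _ (2 ^- n.+1)) => //.
- by move=> x [[]].
- by rewrite invr_ge0 exprn_ge0//= invf_lt1 ?exprn_gt0// exprn_egt1// ltr1n.
move=> N i vi; set Z := _ `\` _ in mZ *.
have mH := @measurable_hcube R n a N i; have mO := @measurable_ocube R n a N i.
have hE : mu (hcube a N i) = ((2 ^- N) ^+ n)%:E := lebesgue_dyadic_box a _ _ N i.
have oE : mu (ocube a N i) = ((2 ^- N) ^+ n)%:E := lebesgue_dyadic_box a _ _ N i.
(* Heaviness concerns open cubes and the density lemma half-open ones; they differ by a null set. *)
have HO : mu (hcube a N i `\` ocube a N i) = 0.
  have : mu (hcube a N i) = mu (hcube a N i `\` ocube a N i) +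
      mu (hcube a N i `&` ocube a N i) := measureDI mu mH mO.
  rewrite (setIidr (@ocube_hcube _ _ a N i)) hE oE => /eqP.
  rewrite eq_sym -[X in _ == X]add0e => /eqP.
  by case: (mu _) => [r| |]//= [/addIr ->].
have H1 : mu (Z `&` hcube a N i) <= mu (Z `&` ocube a N i).
  rewrite -[leRHS]adde0 -HO.
  apply: le_trans (measureU2 _ _ _); [|exact: measurableI|exact: measurableD].
  apply: le_measure; rewrite ?inE.
  - exact: measurableI.
  - by apply: measurableU; [exact: measurableI|exact: measurableD].
  - move=> x [Zx Hx]; have [Ox|nOx] := pselect (ocube a N i x); first by left.
    by right.
rewrite [leRHS](_ : _ = (2 ^- n.+1)%:E * mu (hcube a N i))// hE -EFinM; apply: le_trans H1 _.
have [hi|] := pselect (heavy N i).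
  rewrite (_ : Z `&` _ = set0) ?measure0 ?lee_fin ?mulr_ge0 ?exprn_ge0 ?invr_ge0 ?exprn_ge0//.
  by apply/seteqP; split => // x [[_ nh] Ox]; apply: nh; exists N, i.
move=> /not_andP[//|/negP]; rewrite -leNgt; apply: le_trans.
apply: le_measure; rewrite ?inE; [exact: measurableI|exact: measurableI|].
by move=> x [[[? _] _] ?].
Qed.

End calderon_zygmund.

Lemma heavy_set_subset {R : realType} n (a : n.-tuple R) (E F : set (n.-tuple R)) :
  measurable E -> measurable F -> E `<=` F -> heavy_set a E `<=` heavy_set a F.
Proof.
move=> mE mF EF x [N [i [[vi hi] xi]]]; exists N, i; split => //; split => //.
apply: lt_le_trans hi _; apply: le_measure; rewrite ?inE; last exact: setSI.
- by apply: measurableI => //; exact: measurable_ocube.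
- by apply: measurableI => //; exact: measurable_ocube.
Qed.

(** For packings that consist of a single cube. *)
Lemma eseries_pred1 {R : realType} (u : nat -> \bar R) :
  (\sum_(i <oo | i == 0%N) u i = u 0%N)%E.
Proof.
apply: lim_near_cst => //; exists 1%N => // m /= m1.
rewrite big_ltn_cond//= big_nat_cond big1 ?adde0// => i /andP[/andP[i1 _] /eqP i0].
by move: i1; rewrite i0.
Qed.

(** * The mass of g on the stopping cubes of a level set *)

Section garsia_rodemich_lower_bound.
Context {R : realType}.
Variables (n : nat) (a : n.-tuple R) (Q0 : set (n.-tuple R)).
Let mu := @lebesgue_tuple R n.
Hypotheses (mQ0 : measurable Q0) (Q0u : mu (Q0 `\` unit_box a) = 0%E)
  (Q0cube : forall N i, valid N i -> ocube a N i `<=` Q0).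
Variables (f g : n.-tuple R -> R).
Hypothesis fg : Gamma mu (@cube R n) (@interior_tuple R n) Q0 f g.
Local Open Scope ereal_scope.

Let packing_cube := packing (@cube R n) (@interior_tuple R n) Q0.

Lemma interior_tuple_subset (A : set (n.-tuple R)) : interior_tuple A `<=` A.
Proof. by move=> x [e e0]; apply => j; rewrite subrr normr0. Qed.

Lemma cube_ocube N i : cube (ocube a N i).
Proof.
exists (corner a N i), (2 ^- N)%R, (fun=> false), (fun=> true).
by rewrite invr_gt0 exprn_gt0.
Qed.

Lemma measurable_Gamma : measurable_fun Q0 g.
Proof. by have [/measurable_int/measurable_EFinP] := fg. Qed.

(** g may change sign, but its integral over a cube dominates a nonnegative double integral. *)
Lemma Gamma_integral_ocube_ge0 N i : valid N i ->
  0 <= \int[mu]_(x in ocube a N i) (g x)%:E.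
Proof.
move=> vi; have /(_ (pred1 0%N) (fun=> ocube a N i)) := fg.2.
rewrite !eseries_pred1 => H; apply: (le_trans _ (H _)).
  apply: mule_ge0; first by rewrite lee_fin invr_ge0 fine_ge0// measure_ge0.
  by apply: integral_ge0 => x _; apply: integral_ge0 => y _; rewrite lee_fin.
split => [k _|k l /eqP -> /eqP ->//].
by split; [exact: cube_ocube|exact: Q0cube].
Qed.

Variables (G : n.-tuple R -> R) (c : R).
Hypotheses (mG : measurable_fun Q0 G)
  (Gf : forall x y, Q0 x -> Q0 y -> (`|G x - G y| <= `|f x - f y|)%R).
Let E := Q0 `&` [set x | (c < G x)%R].
Hypothesis E2 : mu E <= (2^-1)%:E.

Lemma measurable_gt_level : measurable E.
Proof.
have := measurable_fun_ltr (measurable_cst c) mG.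
by move=> /(_ mQ0 [set true]); apply.
Qed.

Let mE := measurable_gt_level.

Let mGc (A : set (n.-tuple R)) : measurable A -> A `<=` Q0 ->
  measurable_fun A (fun x => (G x - c)%:E).
Proof.
move=> mA AQ; apply/measurable_EFinP; apply: measurable_funB => //.
exact: measurable_funS mG.
Qed.

(** For x in E and y in the cube but not in E, |f x - f y| >= G x - G y >= G x - c. By
    [selected_half] such y fill at least half of the cube, whence the factor 1/2. *)
Lemma selected_integral_ge N i : selected a E N i ->
  (2^-1)%:E * \int[mu]_(x in E `&` ocube a N i) (G x - c)%:E <=
  (fine (mu (ocube a N i)))^-1%:E *
    \int[mu]_(x in ocube a N i) \int[mu]_(y in ocube a N i) `|f x - f y|%:E.
Proof.
move=> si; have vi := si.1.1.
have mO := @measurable_ocube R n a N i.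
have OQ := Q0cube vi.
set q : R := ((2 ^- N) ^+ n)%R.
have qE : mu (ocube a N i) = q%:E := lebesgue_dyadic_box a _ _ N i.
have q0 : (0 < q)%R by rewrite exprn_gt0// invr_gt0 exprn_gt0.
rewrite qE/=.
rewrite (_ : (2^-1)%:E = q^-1%:E * (q / 2)%:E); last first.
  by rewrite -EFinM mulrA mulVf ?mul1r// gt_eqF.
rewrite -muleA; apply: lee_wpmul2l; first by rewrite lee_fin invr_ge0 ltW.
have mEO : measurable (E `&` ocube a N i) by exact: measurableI.
rewrite -ge0_integralZl_EFin//; last 3 first.
- by move=> x [[_ /= cG] _]; rewrite lee_fin subr_ge0 ltW.
- by apply: mGc => // x [[]].
- by rewrite divr_ge0// ltW.
apply: le_integral_subset => [x []//|x [[Qx /= cG] Ox]|x _]; last first.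
  by apply: integral_ge0 => y _; rewrite lee_fin.
apply/andP; split; first by rewrite mule_ge0 ?lee_fin ?divr_ge0 ?(ltW q0)// subr_ge0 ltW.
have mOE : measurable (ocube a N i `\` E) by exact: measurableD.
apply: (@le_trans _ _ (\int[mu]_(y in ocube a N i `\` E) (G x - c)%:E)); last first.
  apply: le_integral_subset => [y []//|y [Oy nEy]|y _]; last by rewrite lee_fin.
  rewrite !lee_fin subr_ge0 (ltW cG)/=; apply: le_trans (Gf Qx (OQ _ Oy)).
  have Gy : (G y <= c)%R by rewrite leNgt; apply/negP => cy; apply: nEy; split => //; exact: OQ.
  by rewrite (le_trans _ (ler_norm _))// lerB.
have key : (q / 2)%:E <= mu (ocube a N i `\` E); last first.
  by rewrite integral_cst// muleC lee_pmul2l ?lte_fin ?subr_gt0.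
have := selected_half mE E2 si; rewrite setIC -/mu -/q.
have : mu (ocube a N i) = mu (ocube a N i `\` E) + mu (ocube a N i `&` E) := measureDI mu mO mE.
rewrite qE; case: (mu (_ `\` _)) => [u| |]; case: (mu (_ `&` _)) => [v| |]//=.
by move=> [->]; rewrite !lee_fin => ?; lra.
Qed.

(** The condition on g is applied to the packing of all selected cubes, and [selected_integral_ge]
    is summed over them; they cover E up to a null set. *)
Lemma garsia_rodemich_lower_bound :
  (2^-1)%:E * \int[mu]_(x in E) (G x - c)%:E <= \int[mu]_(x in heavy_set a E) `|g x|%:E.
Proof.
have pk : packing_cube (cz_pred a E) (cz_cube a).
  split.
    move=> k /cz_predP[p [_ sp ->]]; split; first exact: cube_ocube.
    by apply: Q0cube; exact: sp.1.1.
  move=> k l pk pl kl; apply/seteqP; split => // x [/interior_tuple_subset xk].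
  move=> /interior_tuple_subset xl; move/eqP : kl; apply.
  by apply: (cz_cube_disjoint pk pl); exists x.
have cellQ k : cz_cell a E k `<=` Q0.
  rewrite /cz_cell; case: ifPn => [/cz_predP[p [_ sp ->]]|_]; last exact: sub0set.
  by apply: Q0cube; exact: sp.1.1.
have mO := measurable_heavy_set a E.
have OQ : heavy_set a E `<=` Q0 by rewrite heavy_setE => x [k _ /cellQ].
have mg := measurable_Gamma.
have /(_ _ _ pk) := fg.2 => H.
apply: (@le_trans _ _ (\sum_(k <oo | cz_pred a E k)
    ((2^-1)%:E * \int[mu]_(x in E `&` cz_cube a k) (G x - c)%:E))).
  rewrite nneseriesZl//; last first.
    move=> k _; apply: integral_ge0 => x [[_ /= cG] _].
    by rewrite lee_fin subr_ge0 ltW.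
  apply: lee_wpmul2l; first by rewrite lee_fin.
  rewrite eseries_mkcond.
  rewrite [leRHS](_ : _ = \sum_(k <oo) \int[mu]_(x in E `&` cz_cell a E k) (G x - c)%:E); last first.
    apply: eq_eseriesr => k _; rewrite /cz_cell; case: ifPn => // _.
    by rewrite setI0 integral_set0.
  have mEc k : measurable (E `&` cz_cell a E k).
    by apply: measurableI => //; exact: measurable_cz_cell.
  have mEO : measurable (E `&` heavy_set a E) by exact: measurableI.
  have EOE : \bigcup_k (E `&` cz_cell a E k) = E `&` heavy_set a E.
    by rewrite -setI_bigcupr heavy_setE.
  rewrite -ge0_integral_bigcup//; last 3 first.
  - by rewrite EOE; apply: mGc => // x [[]].
  - by rewrite EOE => x [[_ /= cG] _]; rewrite lee_fin subr_ge0 ltW.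
  - by apply: trivIset_setIl; exact: trivIset_cz_cell.
  rewrite EOE.
  (* What is left of E lies either in the part of the unit box treated by [heavy_set_covers] or in
     the null set of boundary points outside the box. *)
  have N0 : mu (E `\` heavy_set a E) = 0.
    apply: (@subset_measure0 _ _ _ _ _ (((E `&` unit_box a) `\` heavy_set a E)
       `|` (Q0 `\` unit_box a))).
    - exact: measurableD.
    - apply: measurableU; apply: measurableD => //; last exact: measurable_unit_box.
      by apply: measurableI => //; exact: measurable_unit_box.
    - move=> x [Ex nO]; have [xu|xu] := pselect (unit_box a x); first by left.
      by right; split => //; exact: Ex.1.
    - apply/eqP; rewrite eq_le measure_ge0 andbT.
      apply: le_trans (measureU2 _ _ _) _.
      + apply: measurableD => //.
        by apply: measurableI => //; exact: measurable_unit_box.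
      + by apply: measurableD => //; exact: measurable_unit_box.
      + by rewrite [X in X + _](heavy_set_covers a mE) add0e; move/eqP: Q0u; rewrite eq_le => /andP[].
  rewrite (ge0_negligible_integral (measurableD mE mO) mE _ _ N0)//.
  - by rewrite setDD.
  - by apply: mGc => // x [].
  - by move=> x [_ /= cG]; rewrite lee_fin subr_ge0 ltW.
apply: (@le_trans _ _ (\sum_(k <oo | cz_pred a E k) \int[mu]_(x in cz_cube a k) (g x)%:E)).
  apply: le_trans H; apply: lee_nneseries => k.
    move=> _ _; apply: mule_ge0; first by rewrite lee_fin.
    by apply: integral_ge0 => x [[_ /= cG] _]; rewrite lee_fin subr_ge0 ltW.
  by move=> /cz_predP[p [_ sp ->]]; exact: selected_integral_ge.
rewrite eseries_mkcond heavy_setE ge0_integral_bigcup//; last 3 first.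
- exact: measurable_cz_cell.
- rewrite -heavy_setE; apply/measurable_EFinP; apply: measurableT_comp => //.
  exact: measurable_funS mg.
- exact: trivIset_cz_cell.
apply: lee_nneseries => k; rewrite /cz_cell; case: ifPn => //; last by rewrite integral_set0.
  by move=> /cz_predP[p [_ sp ->]] _ _; apply: Gamma_integral_ocube_ge0; exact: sp.1.1.
move=> pk' _; have cQ : cz_cube a k `<=` Q0 by have := @cellQ k; rewrite /cz_cell pk'.
have mc := @measurable_cz_cube R n a k.
apply: (@le_trans _ _ `|\int[mu]_(x in cz_cube a k) (g x)%:E|); first exact: lee_abs.
apply: le_abse_integral => //.
by apply/measurable_EFinP; exact: measurable_funS mg.
Qed.

End garsia_rodemich_lower_bound.

(** * Allocation of nested resources *)

Section density_measure.
Context {d : measure_display} {T : measurableType d} {R : realType}.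
Variables (mu : {measure set T -> \bar R}) (h : T -> \bar R).
Hypotheses (mh : measurable_fun setT h) (h0 : forall x, (0 <= h x)%E).
Local Open Scope ereal_scope.

Lemma integral_semi_sigma_additive :
  semi_sigma_additive (fun A => \int[mu]_(x in A) h x).
Proof.
move=> F mF tF mUF; rewrite ge0_integral_bigcup//; last exact: measurable_funTS.
by apply: is_cvg_ereal_nneg_natsum => k _; exact: integral_ge0.
Qed.

Lemma ge0_integral_null (A : set T) : measurable A -> mu A = 0 ->
  \int[mu]_(x in A) h x = 0.
Proof.
move=> mA A0; rewrite (ge0_negligible_integral mA mA _ _ A0)//.
  by rewrite setDv integral_set0.
exact: measurable_funTS.
Qed.

(** Packaged as a measure, the mass of |g| is additive and continuous along monotone sequences of
    sets, as the allocation requires. *)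
Lemma density_measure_exists :
  exists kappa : {measure set T -> \bar R}, forall A, kappa A = \int[mu]_(x in A) h x.
Proof.
pose k A := \int[mu]_(x in A) h x.
have k0 : k set0 = 0 by exact: integral_set0.
have kge0 A : 0 <= k A by exact: integral_ge0.
pose K := isMeasure.Build _ _ _ k k0 kge0 integral_semi_sigma_additive.
by exists (HB.pack_for {measure set T -> \bar R} k K).
Qed.

End density_measure.

Section nonatomic.
Context {d : measure_display} {T : measurableType d} {R : realType}.
Variables (kappa : {measure set T -> \bar R}) (t : T -> R).
Hypotheses (kappaT : (kappa setT < +oo)%E) (mt : measurable_fun setT t)
  (t0 : forall c, kappa (t @^-1` [set c]) = 0%E).
Local Open Scope ereal_scope.

Let fin_kappa A : measurable A -> kappa A \is a fin_num.
Proof.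
move=> mA; rewrite ge0_fin_numE ?measure_ge0//; apply: le_lt_trans kappaT.
by apply: le_measure; rewrite ?inE.
Qed.

Let mlt (W : set T) (s : R) : measurable W -> measurable (W `&` [set x | (t x < s)%R]).
Proof.
move=> mW; apply: measurableI => //; rewrite -[X in measurable X]setTI.
by apply: (measurable_fun_ltr (g := cst s)).
Qed.

(** An intermediate value argument for F s = kappa (W [&] [t < s]). At the supremum s0 of the levels
    with F s <= q, continuity from below gives F s0 <= q and continuity from above gives mass at
    least q on [t <= s0]; the set [t = s0] is null. *)
Lemma nonatomic_subset (W : set T) (q : R) : measurable W -> 0 <= q%:E <= kappa W ->
  exists B, [/\ measurable B, B `<=` W & kappa B = q%:E].
Proof.
move=> mW /andP[q0 qW].
have [->|qn0] := eqVneq q 0%R; first by exists set0; rewrite measure0; split.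
have [qWE|qnW] := eqVneq q%:E (kappa W); first by exists W; split.
have {}q0 : (0 < q)%R by rewrite lt_neqAle eq_sym qn0 -lee_fin.
have {}qW : q%:E < kappa W by rewrite lt_neqAle qnW.
pose F s := kappa (W `&` [set x | (t x < s)%R]).
have Fle (s s' : R) : (s <= s')%R -> F s <= F s'.
  move=> ss'; apply: le_measure; rewrite ?inE; try exact: mlt.
  by move=> x [Wx /= xs]; split => //=; exact: lt_le_trans xs ss'.
pose S := [set s | F s <= q%:E].
have SltP s : ~ S s -> q%:E < F s by move=> /negP; rewrite -ltNge.
have S0 : S !=set0.
  have : F (- k%:R)%R @[k --> \oo] --> kappa (\bigcap_k (W `&` [set x | (t x < - k%:R)%R])).
    apply: nonincreasing_cvg_mu.
    - by rewrite -ge0_fin_numE ?measure_ge0// fin_kappa//; exact: mlt.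
    - by move=> k; exact: mlt.
    - by apply: bigcapT_measurable => k; exact: mlt.
    - apply/nonincreasing_seqP => k; apply/subsetPset => x [Wx /= xk]; split => //=.
      by apply: lt_le_trans xk _; rewrite lerN2 ler_nat.
  rewrite (_ : \bigcap_k _ = set0) ?measure0; last first.
    apply/seteqP; split => // x /= H; have [_ /=] := H (Num.truncn `|t x|).+1 I.
    apply/negP; rewrite -leNgt lerNl; apply: le_trans (ltW (truncnS_gt _)).
    by rewrite -normrN ler_norm.
  move=> /fine_cvgP[_ /cvgr_lt/(_ _ q0)[k _ /(_ k (leqnn _))/= Fk]].
  exists (- k%:R)%R; rewrite /S/= -[F _]fineK ?lee_fin ?ltW// fin_kappa//.
  exact: mlt.
have Sub : has_ubound S.
  have : F k%:R @[k --> \oo] --> kappa (\bigcup_k (W `&` [set x | (t x < k%:R)%R])).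
    apply: nondecreasing_cvg_mu.
    - by move=> k; exact: mlt.
    - by apply: bigcupT_measurable => k; exact: mlt.
    - apply/nondecreasing_seqP => k; apply/subsetPset => x [Wx /= xk]; split => //=.
      by apply: lt_le_trans xk _; rewrite ler_nat.
  rewrite (_ : \bigcup_k _ = W); last first.
    apply/seteqP; split => [x [k _ []]//|x Wx]; exists (Num.truncn (t x)).+1 => //.
    by split => //=; exact: truncnS_gt.
  rewrite -[X in _ --> X]fineK ?fin_kappa// => /fine_cvgP[_].
  have qW' : (q < fine (kappa W))%R by rewrite -lte_fin fineK// fin_kappa.
  move=> /cvgr_gt/(_ _ qW')[k _ /(_ k (leqnn _))/= Fk].
  exists k%:R => s /= Ss; rewrite leNgt; apply/negP => ks.
  have := Fle _ _ (ltW ks) => /le_trans/(_ Ss).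
  by rewrite -[F _]fineK ?lee_fin ?leNgt ?Fk// fin_kappa//; exact: mlt.
have supS : has_sup S by split.
pose s0 := sup S.
exists (W `&` [set x | (t x < s0)%R]); split => //; first exact: mlt.
apply/eqP; rewrite eq_le; apply/andP; split.
  have : F (s0 - k.+1%:R^-1)%R @[k --> \oo] -->
      kappa (\bigcup_k (W `&` [set x | (t x < s0 - k.+1%:R^-1)%R])).
    apply: nondecreasing_cvg_mu.
    - by move=> k; exact: mlt.
    - by apply: bigcupT_measurable => k; exact: mlt.
    - apply/nondecreasing_seqP => k; apply/subsetPset => x [Wx /= xk]; split => //=.
      by apply: lt_le_trans xk _; rewrite lerD2l lerN2 lef_pV2 ?posrE// ler_nat.
  rewrite (_ : \bigcup_k _ = W `&` [set x | (t x < s0)%R]); last first.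
    apply/seteqP; split => [x [k _ [Wx /= xk]]|x [Wx /= xs]].
      by split => //=; apply: lt_le_trans xk _; rewrite gerBl.
    have [k] := ltr_add_invr xs; rewrite -ltrBrDr => tk.
    by exists k.
  move=> /cvg_lim <- //; apply: lime_le.
    by apply: ereal_nondecreasing_is_cvgn => k l kl; apply: Fle;
      rewrite lerD2l lerN2 lef_pV2 ?posrE// ler_nat.
  apply: nearW => k; have : (s0 - k.+1%:R^-1 < s0)%R by rewrite gtrBl.
  move=> /(sup_gt S0)[s Ss /ltW/Fle]; move/le_trans; exact.
have : F (s0 + k.+1%:R^-1)%R @[k --> \oo] -->
    kappa (\bigcap_k (W `&` [set x | (t x < s0 + k.+1%:R^-1)%R])).
  apply: nonincreasing_cvg_mu.
  - by rewrite -ge0_fin_numE ?measure_ge0// fin_kappa//; exact: mlt.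
  - by move=> k; exact: mlt.
  - by apply: bigcapT_measurable => k; exact: mlt.
  - apply/nonincreasing_seqP => k; apply/subsetPset => x [Wx /= xk]; split => //=.
    by apply: lt_le_trans xk _; rewrite lerD2l lef_pV2 ?posrE// ler_nat.
move=> cvF.
apply: (@le_trans _ _ (kappa (\bigcap_k (W `&` [set x | (t x < s0 + k.+1%:R^-1)%R])))).
  move/cvg_lim : (cvF) => <- //; apply: lime_ge.
    by apply: ereal_nonincreasing_is_cvgn => k l kl; apply: Fle;
      rewrite lerD2l lef_pV2 ?posrE// ler_nat.
  apply: nearW => k; apply: ltW; apply: SltP => Ss.
  have := ub_le_sup Sub Ss; rewrite -/s0.
  by apply/negP; rewrite -ltNge ltrDl.
rewrite -[leRHS]adde0 -(t0 s0).
have ms0 : measurable (t @^-1` [set s0]) by rewrite -[X in measurable X]setTI; exact: mt.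
apply: le_trans (measureU2 _ _ _) => //; last exact: mlt.
apply: le_measure; rewrite ?inE.
- by apply: bigcapT_measurable => k; exact: mlt.
- by apply: measurableU => //; exact: mlt.
- move=> x H; have [Wx _] := H 0%N I.
  have [xs|] := ltP (t x) s0; first by left.
  rewrite le_eqVlt => /predU1P[->|sx]; first by right.
  have [k] := ltr_add_invr sx; have [_ /= +] := H k I.
  by move=> /lt_trans/[apply]; rewrite ltxx.
Qed.

Lemma nonatomic_between (U V : set T) (q : R) : measurable U -> measurable V ->
  U `<=` V -> kappa U <= q%:E <= kappa V ->
  exists B, [/\ measurable B, U `<=` B, B `<=` V & kappa B = q%:E].
Proof.
move=> mU mV UV /andP[Uq qV].
have mVU : measurable (V `\` U) by exact: measurableD.
have VE : kappa V = kappa (V `\` U) + kappa U.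
  by have : kappa V = _ := measureDI kappa mV mU; rewrite (setIidr UV).
have Ufin := fin_kappa mU.
have [|B [mB BV Bq]] := @nonatomic_subset (V `\` U) (q - fine (kappa U)) mVU.
  move: Uq qV; rewrite VE -(fineK Ufin) -(fineK (fin_kappa mVU)) -EFinD !lee_fin/=.
  by move=> ? ?; apply/andP; split; lra.
exists (B `|` U); split => //.
- exact: measurableU.
- by rewrite subUset; split => // x /BV[].
- have -> : kappa (B `|` U) = kappa B + kappa U.
    by apply: measureU => //; apply/seteqP; split => // x [/BV[]].
  by rewrite Bq EFinB fineK// subeK.
Qed.

(* Demands D i have to be served from the nested resources O i.  The first one
   takes the innermost mass, so that nothing is wasted for the others. *)
Lemma allocation_step (O : nat -> set T) (D : nat -> R) :
  (forall i, measurable (O i)) -> (forall i j, (i <= j)%N -> O j `<=` O i) ->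
  (forall i, 0 <= D i <= D 0%N)%R -> (forall i, (D i)%:E <= kappa (O i)) ->
  kappa (O i) @[i --> \oo] --> 0 ->
  exists B, [/\ measurable B, B `<=` O 0%N, kappa B = (D 0%N)%:E &
    forall i, (D i)%:E <= kappa (B `&` O i)].
Proof.
move=> mO dO D0 DO cvO.
have [D00|D0n] := eqVneq (D 0%N) 0%R.
  exists set0; split => //; first by rewrite measure0 D00.
  by move=> i; rewrite set0I measure0 lee_fin -D00; have /andP[] := D0 i.
have D0gt : (0 < D 0)%R by rewrite lt_neqAle eq_sym D0n; have /andP[] := D0 0%N.
(* At the first such index j.+1, B is chosen between O j.+1 and O j. For i <= j all of B lies in O i
   and D i <= D 0; for i > j all of O i lies in B. *)
have exj : exists j, kappa (O j) < (D 0%N)%:E.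
  move/fine_cvgP : cvO => [_ /cvgr_lt/(_ _ D0gt)[k _ /(_ k (leqnn _))/= Ok]].
  by exists k; rewrite -[ltLHS]fineK ?lte_fin// fin_kappa.
have [[|j]] := ex_minnP exj; first by rewrite ltNge DO.
move=> Oj minj.
have Oj' : (D 0%N)%:E <= kappa (O j).
  by rewrite leNgt; apply/negP => /minj; rewrite ltnn.
have [|B [mB OB BO BD]] := @nonatomic_between (O j.+1) (O j) (D 0%N) (mO _) (mO _) (dO _ _ (leqnSn _)).
  by rewrite (ltW Oj).
exists B; split => //.
- exact: subset_trans BO (dO _ _ (leq0n _)).
- move=> i; have [ij|ji] := leqP i j.
    rewrite (setIidl (subset_trans BO (dO _ _ ij))) BD lee_fin.
    by have /andP[] := D0 i.
  by rewrite (setIidr (subset_trans (dO _ _ ji) OB)).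
Qed.

(** Here D i is the total demand of the indices from i on. Iterating [allocation_step] gives
    decreasing sets B k of mass D k, and index k receives B k minus B k.+1. *)
Lemma allocation (O : nat -> set T) (D : nat -> R) :
  (forall i, measurable (O i)) -> (forall i j, (i <= j)%N -> O j `<=` O i) ->
  (forall i j, (i <= j)%N -> (0 <= D j <= D i)%R) ->
  (forall i, (D i)%:E <= kappa (O i)) -> kappa (O i) @[i --> \oo] --> 0 ->
  exists A : nat -> set T, [/\ forall i, measurable (A i), forall i, A i `<=` O i,
    trivIset setT A & forall i, kappa (A i) = (D i - D i.+1)%:E].
Proof.
move=> mO dO dD DO cvO.
(* The invariant: inside B there is still enough mass for the total demands from k on. *)
pose P k B := measurable B /\ forall i, (k <= i)%N -> (D i)%:E <= kappa (B `&` O i).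
pose Q k B B' := [/\ P k B', B' `<=` B, B' `<=` O k & kappa B' = (D k)%:E].
have /choice[F HF] : forall kB : nat * set T, exists B', P kB.1 kB.2 -> Q kB.1 kB.2 B'.
  move=> [k B] /=; have [[mB PB]|nP] := pselect (P k B); last by exists set0.
  have [||||| B' [mB' B'O B'D B'i]] :=
      @allocation_step (fun i => B `&` O (k + i)%N) (fun i => D (k + i)%N).
  - by move=> i; exact: measurableI.
  - by move=> i j ij; apply: setIS; apply: dO; rewrite leq_add2l.
  - by move=> i; apply: dD; rewrite addn0 leq_addr.
  - by move=> i; apply: PB; exact: leq_addr.
  - have cvOk : kappa (O (k + i)%N) @[i --> \oo] --> 0.
      rewrite (_ : (fun i => _) = [sequence (kappa \o O) (i + k)%N]_i) ?cvg_shiftn//.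
      by apply/funext => i; rewrite /= addnC.
    apply: (squeeze_cvge _ (cvg_cst 0) cvOk); apply: nearW => i.
    rewrite measure_ge0/=; apply: le_measure; rewrite ?inE//; exact: measurableI.
  exists B' => _; split => //.
  - split => // i ki; have := B'i (i - k)%N; rewrite subnKC// => /le_trans; apply.
    apply: le_measure; rewrite ?inE; last by apply: setIS; exact: subIsetr.
    + by apply: measurableI => //; exact: measurableI.
    + exact: measurableI.
  - by move=> x /B'O[].
  - by move=> x /B'O[_]; rewrite addn0.
  - by rewrite B'D addn0.
pose B := fix B k := if k is k'.+1 then F (k, B k') else F (0%N, setT).
have PT : P 0%N setT by split => // i _; rewrite setTI.
have QB k : Q k (if k is k'.+1 then B k' else setT) (B k).
  elim: k => [|k IH]; first exact: (HF (0%N, setT)).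
  apply: (HF (k.+1, B k)); case: IH => -[mB PB] _ _ _; split => // i ki.
  by apply: PB; exact: ltnW.
have mB k : measurable (B k) by case: (QB k) => -[].
have BS k : B k.+1 `<=` B k by case: (QB k.+1).
have Bd k l : (k <= l)%N -> B l `<=` B k.
  move=> kl; rewrite -(subnK kl); elim: (l - k)%N => // m IH.
  by apply: subset_trans IH; rewrite addSn; exact: BS.
exists (fun k => B k `\` B k.+1); split.
- by move=> k; exact: measurableD.
- by move=> k x []; case: (QB k) => _ _ + _ => /[apply].
- move=> k l _ _ [x [[Bk nBk] [Bl nBl]]].
  have [kl|lk|//] := ltngtP k l.
    by case: nBk; exact: (Bd k.+1 l).
  by case: nBl; exact: (Bd l.+1 k).
- move=> k; have mD : measurable (B k `\` B k.+1) by exact: measurableD.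
  have : kappa (B k) = kappa (B k `\` B k.+1) + kappa (B k.+1).
    by have := measureDI kappa (mB k) (mB k.+1); rewrite (setIidr (BS k)).
  have [_ _ _ ->] := QB k; have [_ _ _ ->] := QB k.+1.
  by rewrite -(fineK (fin_kappa mD)) -EFinD => -[->]; rewrite addrK.
Qed.

End nonatomic.

(** * Serving the levels of G from the mass of g *)

Section level_allocation.
Context {R : realType}.
Variables (n : nat) (a : n.-tuple R) (Q0 : set (n.-tuple R)).
Let mu := @lebesgue_tuple R n.
Hypotheses (n_gt0 : (0 < n)%N)
  (mQ0 : measurable Q0) (Q01 : mu Q0 = 1%E) (Q0u : mu (Q0 `\` unit_box a) = 0%E)
  (Q0cube : forall N i, valid N i -> ocube a N i `<=` Q0).
Variables (f g : n.-tuple R -> R).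
Hypothesis fg : Gamma mu (@cube R n) (@interior_tuple R n) Q0 f g.
Variables (G : n.-tuple R -> R) (c : nat -> R).
Hypotheses (iG : mu.-integrable Q0 (EFin \o G))
  (Gf : forall x y, Q0 x -> Q0 y -> `|G x - G y| <= `|f x - f y|)
  (c_nd : forall k, c k <= c k.+1).
Local Open Scope ereal_scope.
Hypotheses
  (Gc : forall k, mu (Q0 `&` [set x | (c k < G x)%R]) <= (2 ^- k.+1)%:E)
  (cG : forall k, (2 ^- k.+2)%:E <= mu (Q0 `&` [set x | (c k.+1 <= G x)%R])).

(** A coordinate thus serves as the function with null level sets for [allocation]. *)
Lemma hyperplane_null (j : 'I_n) (r : R) :
  mu ((fun x : n.-tuple R => tnth x j) @^-1` [set r]) = 0.
Proof.
pose A (k : 'I_n) : set R := if k == j then [set r] else setT.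
have mA k : measurable (A k) by rewrite /A; case: ifP => _ //; exact: measurable_set1.
rewrite (_ : _ @^-1` _ = [set x | forall k, A k (tnth x k)]).
  rewrite /mu lebesgue_tuple_box// (bigD1 j)//= {1}/A eqxx.
  by rewrite lebesgue_measure_set1 mul0e.
apply/seteqP; split => x /=; last by move=> /(_ j); rewrite /A eqxx.
by move=> xr k; rewrite /A; case: eqP => // ->.
Qed.

Let E k := Q0 `&` [set x | (c k < G x)%R].
Let Gpos k x := (Num.max (G x - c k) 0)%R.

Let mG : measurable_fun Q0 G.
Proof. by have /measurable_int/measurable_EFinP := iG. Qed.

Let mE k : measurable (E k).
Proof. exact: measurable_gt_level. Qed.

Let mGpos k : measurable_fun Q0 (EFin \o Gpos k).
Proof.
apply/measurable_EFinP; apply: measurable_funrpos => //.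
exact: measurable_funB.
Qed.

Let Gpos_ge0 k x : 0 <= (Gpos k x)%:E.
Proof. by rewrite lee_fin le_max lexx orbT. Qed.

Let Gpos_fin k : \int[mu]_(x in Q0) (Gpos k x)%:E \is a fin_num.
Proof.
rewrite ge0_fin_numE; last by apply: integral_ge0 => x _; exact: Gpos_ge0.
apply: (@le_lt_trans _ _ (\int[mu]_(x in Q0) (`|G x|%:E + `|c k|%:E))).
  apply: le_integral_subset => // x _.
    rewrite Gpos_ge0 lee_fin ge_max addr_ge0// andbT.
    by rewrite (le_trans (ler_norm _))// ler_normB.
  by rewrite adde_ge0.
rewrite ge0_integralD//; last first.
  by apply/measurable_EFinP; apply: measurableT_comp.
rewrite integral_cst// [X in _ + _ * X]Q01 mule1 lte_add_pinfty ?ltry//.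
by have /integrableP[] := iG.
Qed.

Let D k := (2^-1 * fine (\int[mu]_(x in Q0) (Gpos k x)%:E))%R.

Let DE k : (D k)%:E = (2^-1)%:E * \int[mu]_(x in E k) (G x - c k)%:E.
Proof.
rewrite /D EFinM fineK ?Gpos_fin//; congr (_ * _).
rewrite /E integral_mkcondr; apply: eq_integral => x _.
rewrite /Gpos /patch; case: ifPn => [/set_mem/= cx|].
  by rewrite max_l// subr_ge0 ltW.
by rewrite notin_setE/= => /negP; rewrite -leNgt => Gx; rewrite max_r// subr_le0.
Qed.

Let D_ge0 k : (0 <= D k)%R.
Proof.
by rewrite mulr_ge0// fine_ge0//; apply: integral_ge0 => x _; exact: Gpos_ge0.
Qed.

(** The excess of G over c k is at least its excess over c k.+1 plus the full step c k.+1 - c k on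
    the set where G >= c k.+1, and that set has measure at least 2^-(k+2). *)
Let D_step k : (2^-1 * (2 ^- k.+2 * (c k.+1 - c k)) <= D k - D k.+1)%R.
Proof.
rewrite /D -mulrBr ler_pM2l// lerBrDr.
have mGe : measurable (Q0 `&` [set x | (c k.+1 <= G x)%R]).
  by have /(_ mQ0 [set true]) := measurable_fun_ler (measurable_cst (c k.+1)) mG; apply.
have ck : (0 <= c k.+1 - c k)%R by rewrite subr_ge0.
rewrite -lee_fin EFinD !fineK ?Gpos_fin//.
apply: (@le_trans _ _ (\int[mu]_(x in Q0)
    ((c k.+1 - c k)%:E * (\1_(Q0 `&` [set x | (c k.+1 <= G x)%R]) x)%:E + (Gpos k.+1 x)%:E))).
  rewrite ge0_integralD//.
  - rewrite leeD2r// ge0_integralZl_EFin//; last first.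
      by apply/measurable_EFinP; exact: measurable_indic.
    rewrite integral_indic// EFinM muleC; apply: lee_wpmul2l; first by rewrite lee_fin.
    by rewrite (_ : _ `&` Q0 = Q0 `&` [set x | (c k.+1 <= G x)%R]) ?cG// setIAC setIid.
  - by move=> x _; rewrite mule_ge0// lee_fin.
  - apply: measurable_funeM; apply/measurable_EFinP; exact: measurable_indic.
  - exact: mGpos.
apply: le_integral_subset => // x Qx.
rewrite adde_ge0 ?Gpos_ge0 ?mule_ge0 ?lee_fin//= /Gpos indicE.
case: (leP (c k.+1) (G x)) => cx.
  rewrite mem_set//= mulr1 !max_l ?subr_ge0//; first by lra.
  exact: le_trans (c_nd k) cx.
rewrite memNset/=; last by move=> [_ /=]; rewrite leNgt cx.
by rewrite mulr0 add0r [leLHS]max_r ?le_max ?lexx ?orbT// subr_le0 ltW.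
Qed.

Lemma level_allocation : exists A : nat -> set (n.-tuple R),
  [/\ forall k, measurable (A k), forall k, A k `<=` Q0, trivIset setT A,
    forall k, mu (A k) <= (2 ^+ n.+1 * 2 ^- k.+1)%:E &
    forall k, (2^-1 * (2 ^- k.+2 * (c k.+1 - c k)))%:E <= \int[mu]_(x in A k) `|g x|%:E].
Proof.
have mg := measurable_Gamma fg.
have mgr : measurable_fun setT ((fun x => `|g x|%:E) \_ Q0).
  apply/(measurable_restrictT (fun x => `|g x|%:E) mQ0).
  by apply/measurable_EFinP; exact: measurableT_comp.
have gr0 x : 0 <= ((fun x => `|g x|%:E) \_ Q0) x by apply: erestrict_ge0.
have [kappa kE] := density_measure_exists mu mgr gr0.
have kQ A : A `<=` Q0 -> kappa A = \int[mu]_(x in A) `|g x|%:E.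
  move=> AQ; rewrite kE; apply: eq_integral => x /set_mem/AQ Qx.
  by rewrite /patch mem_set.
have kT : kappa setT < +oo.
  by rewrite kE -integral_mkcond; have /integrableP[] := fg.1.
pose O k := heavy_set a (E k).
have mO k : measurable (O k) by exact: measurable_heavy_set.
have ck i j : (i <= j)%N -> (c i <= c j)%R.
  by move=> ij; rewrite -(subnK ij); elim: (j - i)%N => // m /le_trans; apply; rewrite addSn.
have OS i j : (i <= j)%N -> O j `<=` O i.
  move=> ij; apply: heavy_set_subset => // x [Qx /= cx]; split => //=.
  exact: le_lt_trans (ck _ _ ij) cx.
have E2 k : mu (E k) <= (2^-1)%:E.
  apply: le_trans (Gc k) _; rewrite lee_fin lef_pV2 ?posrE ?exprn_gt0//.
  by rewrite exprS ler_peMr// exprn_ege1// ler1n.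
have OQ k : O k `<=` Q0 by move=> x [N [i [[vi _] /(Q0cube vi)]]].
have muO k : mu (O k) <= (2 ^+ n.+1 * 2 ^- k.+1)%:E.
  apply: (le_trans (lebesgue_heavy_set a (mE k))).
  by rewrite EFinM; apply: lee_wpmul2l; [rewrite lee_fin exprn_ge0|exact: Gc].
have DO k : (D k)%:E <= kappa (O k).
  rewrite DE kQ; last exact: OQ.
  exact: (garsia_rodemich_lower_bound mQ0 Q0u Q0cube fg mG Gf (E2 k)).
(* The measures of the O k tend to 0, so their intersection is null, hence null for [kappa] as
   well. *)
have kO : kappa (O i) @[i --> \oo] --> 0.
  have mI : measurable (\bigcap_k O k) by exact: bigcapT_measurable.
  have muI : mu (\bigcap_k O k) = 0.
    apply/eqP; rewrite eq_le measure_ge0 andbT.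
    apply/lee_addgt0Pr => e e0; rewrite add0e.
    have e20 : (0 < e / 2 ^+ n.+1)%R by rewrite divr_gt0// exprn_gt0.
    have [N /(_ N.+1 (leqnSn _))] := pow_half_small e20.
    rewrite ltr_pdivlMr ?exprn_gt0// mulrC => /ltW N2.
    apply: (@le_trans _ _ (mu (O N))); last by apply: le_trans (muO N) _; rewrite lee_fin.
    by apply: le_measure; rewrite ?inE//; exact: bigcap_inf.
  have kI : kappa (\bigcap_k O k) = 0.
    by rewrite kE ge0_integral_null.
  rewrite -kI; apply: nonincreasing_cvg_mu => //.
    apply: le_lt_trans kT; apply: le_measure; rewrite ?inE//.
  by apply/nonincreasing_seqP => k; apply/subsetPset; exact: OS.
have dD i j : (i <= j)%N -> (0 <= D j <= D i)%R.
  move=> ij; rewrite D_ge0/= -(subnK ij); elim: (j - i)%N => // m; apply: le_trans.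
  rewrite addSn; rewrite -subr_ge0; apply: le_trans (D_step _).
  by rewrite !mulr_ge0// ?invr_ge0 ?exprn_ge0// subr_ge0.
have t0 (r : R) : kappa ((fun x : n.-tuple R => tnth x (Ordinal n_gt0)) @^-1` [set r]) = 0.
  rewrite kE ge0_integral_null//; last exact: hyperplane_null.
  rewrite -[X in measurable X]setTI; apply: (@measurable_tnth _ R n (Ordinal n_gt0)) => //.
have [A [mA AO tA kA]] := allocation kT (@measurable_tnth _ R n (Ordinal n_gt0)) t0 mO OS dD DO kO.
exists A; split => //.
- by move=> k; exact: subset_trans (AO k) (OQ k).
- by move=> k; apply: le_trans (muO k); apply: le_measure; rewrite ?inE.
- move=> k; rewrite -kQ; last exact: subset_trans (AO k) (OQ k).
  by rewrite kA lee_fin.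
Qed.

End level_allocation.

(** * Oscillation of monotone functions on intervals *)

Section monotone_oscillation.
Context {R : realType}.
Let leb := @lebesgue_measure R.
Local Open Scope ereal_scope.

Lemma subset_unit_itv (x y : R) :
  (0 <= x)%R -> (y <= 1)%R -> (`]x, y[%classic : set R) `<=` unit_itv.
Proof.
move=> x0 y1 z; rewrite /unit_itv/= !in_itv/= => /andP[xz zy].
by rewrite (le_lt_trans x0 xz) (lt_le_trans zy y1).
Qed.

(** Bookkeeping of one bisection: the half that is not bisected further and the change of the
    reference constant cost x each, both paid for by u; w and z come from the recursion. *)
Lemma leeD_halves (j1 j2 j u w : \bar R) (x z : R) :
  j1 <= x%:E -> j2 <= j + x%:E -> j <= w + z%:E -> (2 * x)%:E <= u ->
  j1 + j2 <= u + w + z%:E.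
Proof.
move=> h1 h2 h3 h4; apply: (le_trans (leeD h1 (le_trans h2 (leeD h3 (lexx _))))).
rewrite addeC -addeA addeC -EFinD addeA; apply: leeD => //; apply: leeD => //.
by apply: le_trans h4; rewrite lee_fin; lra.
Qed.

Lemma ge0_integral_itv_split (F : R -> \bar R) (x m y : R) :
  measurable_fun (@unit_itv R) F -> (forall z, unit_itv z -> 0 <= F z) ->
  (0 <= x)%R -> (x <= m)%R -> (m < y)%R -> (y <= 1)%R ->
  \int[leb]_(z in `]x, y[) F z = \int[leb]_(z in `]x, m[) F z + \int[leb]_(z in `]m, y[) F z.
Proof.
move=> mF F0 x0 xm my y1.
have mFs (A : set R) : measurable A -> A `<=` unit_itv -> measurable_fun A F.
  by move=> mA Au; exact: (measurable_funS measurable_unit_itv Au mF).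
have xyu := @subset_unit_itv x y x0 y1.
have [->|xnm] := eqVneq x m; first by rewrite set_itvoo0// integral_set0 add0e.
have {xnm}xm : (x < m)%R by rewrite lt_neqAle xnm.
have myu : (`[m, y[%classic : set R) `<=` unit_itv.
  move=> z; rewrite /unit_itv/= !in_itv/= => /andP[mz zy].
  by rewrite (le_lt_trans x0 (lt_le_trans xm mz)) (lt_le_trans zy y1).
have xmu : (`]x, m[%classic : set R) `<=` unit_itv.
  by apply: (@subset_unit_itv x m) => //; rewrite (le_trans (ltW my)).
have E : (`]x, y[%classic : set R) = `]x, m[ `|` `[m, y[.
  apply/seteqP; split => z /=; rewrite !in_itv/=.
    by move=> /andP[-> ->]/=; rewrite andbT; case: (ltP z m) => ?; [left|right].
  by move=> [/andP[-> zm]|/andP[mz ->]]; rewrite ?(lt_trans zm my)// (lt_le_trans xm mz).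
rewrite E ge0_integral_setU//=; last 3 first.
- by rewrite -E; exact: mFs.
- by move=> z [/xmu|/myu] /F0.
- rewrite disj_set2E; apply/eqP/seteqP; split => // z /=.
  by rewrite !in_itv/= => -[/andP[_ zm] /andP[]]; rewrite leNgt zm.
congr (_ + _); rewrite (@integral_itv_obnd_cbnd R m (BLeft y) F)//.
apply: mFs => // z; rewrite /unit_itv/= !in_itv/= => /andP[mz zy].
by rewrite (le_lt_trans x0 (lt_trans xm mz)) (lt_le_trans zy y1).
Qed.

Variables (h v : R -> R) (K : R).
Hypotheses (mh : measurable_fun (@unit_itv R) h)
  (h_ni : forall s t, (0 < s -> s <= t -> t < 1 -> h t <= h s)%R)
  (h_ge0 : forall s, (0 <= h s)%R)
  (mv : measurable_fun (@unit_itv R) v) (v0 : forall s, (0 <= v s)%R) (K0 : (0 <= K)%R).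

Let pt N (i : nat) : R := (i%:R * 2 ^- N)%R.

Hypothesis tile : forall N i, (0 < i)%N -> (i.+1 < 2 ^ N)%N ->
  (2 ^- N * (h (pt N i) - h (pt N i.+1)))%:E <=
  K%:E * \int[leb]_(x in `]pt N i, pt N i.+1[) (v x)%:E.

Let J (x y c : R) := \int[leb]_(z in `]x, y[) `|h z - c|%:E.
Let V (x y : R) := \int[leb]_(z in `]x, y[) (v z)%:E.

Let mhc (A : set R) c : measurable A -> A `<=` unit_itv ->
  measurable_fun A (fun z => `|h z - c|%:E).
Proof.
move=> mA Au; apply/measurable_EFinP; apply: measurableT_comp => //.
by apply: measurable_funB => //; exact: (measurable_funS measurable_unit_itv Au mh).
Qed.

Let J_split x m y c : (0 <= x)%R -> (x <= m)%R -> (m < y)%R -> (y <= 1)%R ->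
  J x y c = J x m c + J m y c.
Proof.
move=> x0 xm my y1; apply: ge0_integral_itv_split => //.
by apply: mhc => //; exact: measurable_unit_itv.
Qed.

Let V_split x m y : (0 <= x)%R -> (x <= m)%R -> (m < y)%R -> (y <= 1)%R ->
  V x y = V x m + V m y.
Proof.
move=> x0 xm my y1; apply: ge0_integral_itv_split => //.
- exact/measurable_EFinP.
- by move=> z _; rewrite lee_fin.
Qed.

Let V_ge0 x y : 0 <= V x y.
Proof. by apply: integral_ge0 => z _; rewrite lee_fin. Qed.

Let lebesgue_oo x y : (x <= y)%R -> leb `]x, y[%classic = (y - x)%:E.
Proof.
move=> xy; rewrite /leb lebesgue_measure_itv/= lte_fin; case: ltP => // yx.
by rewrite (_ : y = x) ?subrr//; apply/eqP; rewrite eq_le yx xy.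
Qed.

Let J_le x y c M : (0 <= x)%R -> (x <= y)%R -> (y <= 1)%R ->
  (forall z, (x < z < y)%R -> `|h z - c| <= M)%R -> J x y c <= ((y - x) * M)%:E.
Proof.
move=> x0 xy y1 H.
apply: (@le_trans _ _ (\int[leb]_(z in `]x, y[) M%:E)).
  apply: le_integral_subset => // z /=; rewrite in_itv/= => zxy.
    by rewrite !lee_fin normr_ge0 H.
  by rewrite lee_fin (le_trans _ (H z zxy)).
by rewrite integral_cst//; rewrite [X in _ * X]lebesgue_oo// -EFinM mulrC.
Qed.

Let J_triangle x y c c' : (0 <= x)%R -> (x <= y)%R -> (y <= 1)%R ->
  J x y c <= J x y c' + ((y - x) * `|c' - c|)%:E.
Proof.
move=> x0 xy y1.
have xyu := @subset_unit_itv x y x0 y1.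
apply: (@le_trans _ _ (\int[leb]_(z in `]x, y[) (`|h z - c'|%:E + `|c' - c|%:E))).
  apply: le_integral_subset => // z _; last by rewrite -EFinD lee_fin addr_ge0.
  rewrite -EFinD !lee_fin normr_ge0/=.
  by rewrite (_ : (h z - c = (h z - c') + (c' - c))%R) ?ler_normD//; lra.
rewrite ge0_integralD//; last by apply: mhc.
by rewrite integral_cst// [X in _ + _ * X]lebesgue_oo// -EFinM mulrC.
Qed.

Let p_gt0 N : (0 < 2 ^- N :> R)%R. Proof. by rewrite invr_gt0 exprn_gt0. Qed.

Let half_p N : (2 ^- N = 2 * 2 ^- N.+1 :> R)%R.
Proof. by rewrite exprS invfM mulrA divff ?mul1r// pnatr_eq0. Qed.

Let pt_double N i : pt N.+1 i.*2 = pt N i.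
Proof. by rewrite /pt -mul2n natrM mulrAC -half_p mulrC. Qed.

Let ptS N i : pt N i.+1 = (pt N i + 2 ^- N)%R.
Proof. by rewrite /pt -natr1 mulrDl mul1r. Qed.

Let pt_ge0 N i : (0 <= pt N i)%R.
Proof. by rewrite mulr_ge0// ltW. Qed.

Let pt_gt0 N i : (0 < i)%N -> (0 < pt N i)%R.
Proof. by move=> i0; rewrite mulr_gt0// ltr0n. Qed.

Let pt_lt1 N i : (i < 2 ^ N)%N -> (pt N i < 1)%R.
Proof. by move=> iN; rewrite ltr_pdivrMr ?exprn_gt0// mul1r -natrX ltr_nat. Qed.

Let pt_le1 N i : (i <= 2 ^ N)%N -> (pt N i <= 1)%R.
Proof. by move=> iN; rewrite ler_pdivrMr ?exprn_gt0// mul1r -natrX ler_nat. Qed.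

Let tile2 N i : (0 < i)%N -> (i.+1 < 2 ^ N)%N ->
  (2 * (2 ^- N * (h (pt N i) - h (pt N i.+1))))%:E <= (2 * K)%:E * V (pt N i) (pt N i.+1).
Proof.
move=> i0 iN; rewrite EFinM [(2 * K)%:E]EFinM -muleA.
by apply: lee_wpmul2l; [rewrite lee_fin|exact: tile].
Qed.

(* Bisecting: the half that contains x is treated recursively and the other half
   is charged to v by the tile hypothesis; G is the depth of the recursion. *)
Lemma oscillation_left_approx G N i x : (i.+1 < 2 ^ N)%N -> (0 < x)%R ->
  (pt N i <= x < pt N i.+1)%R ->
  J x (pt N i.+1) (h (pt N i.+1)) <=
    (2 * K)%:E * V x (pt N i.+1) + (2 ^- (N + G) * (h x - h (pt N i.+1)))%:E.
Proof.
elim: G N i x => [|G IH] N i x iN x0 /andP[ix xi].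
  have r1 := pt_lt1 iN.
  have hxr : (h (pt N i.+1) <= h x)%R by apply: h_ni => //; exact: ltW.
  rewrite addn0; apply: (@le_trans _ _ ((pt N i.+1 - x) * (h x - h (pt N i.+1)))%:E).
    apply: J_le; rewrite ?(ltW x0) ?(ltW xi) ?(ltW r1)// => z /andP[xz zr].
    have hz1 : (h (pt N i.+1) <= h z)%R by apply: h_ni; rewrite ?(lt_trans x0 xz)// ltW.
    have hz2 : (h z <= h x)%R by apply: h_ni => //; [exact: ltW|exact: lt_trans zr r1].
    by rewrite ger0_norm ?subr_ge0// lerD2r.
  rewrite -[leLHS]add0e leeD//; first by rewrite mule_ge0// lee_fin mulr_ge0.
  by rewrite lee_fin ler_wpM2r ?subr_ge0// lerBlDr addrC ptS lerD2r.
set m := pt N.+1 i.*2.+1.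
have rE : pt N i.+1 = pt N.+1 i.*2.+2 by rewrite -pt_double doubleS.
have iN1 : (i.*2.+2 < 2 ^ N.+1)%N by rewrite -doubleS expnS mul2n ltn_double.
have mr : (m < pt N i.+1)%R by rewrite rE [ltRHS]ptS ltrDl.
have r1 := pt_lt1 iN.
have m0 : (0 < m)%R by exact: pt_gt0.
have [mx|xm] := leP m x.
  by have := IH N.+1 i.*2.+1 x iN1 x0; rewrite -rE mx xi addSnnS; apply.
have IHx := IH N.+1 i.*2 x (ltn_trans (ltnSn _) iN1) x0.
have {IHx} := IHx _; rewrite pt_double -/m ix xm => /(_ isT) IHx.
have hm : (h (pt N i.+1) <= h m)%R by apply: h_ni => //; exact: ltW.
have hxm : (h m <= h x)%R by apply: h_ni => //; [exact: ltW|exact: lt_trans mr r1].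
have mN : (m - x <= 2 ^- N.+1)%R by rewrite lerBlDl /m ptS pt_double lerD2r.
have rmE : (pt N i.+1 - m = 2 ^- N.+1)%R by rewrite rE [X in (X - _)%R]ptS -/m addrAC subrr add0r.
rewrite (J_split _ (ltW x0) (ltW xm) mr (ltW r1)).
rewrite (V_split (ltW x0) (ltW xm) mr (ltW r1)).
have h1 : J x m (h (pt N i.+1)) <= J x m (h m) + (2 ^- N.+1 * (h m - h (pt N i.+1)))%:E.
  apply: (le_trans (J_triangle _ (h m) (ltW x0) (ltW xm) (le_trans (ltW mr) (ltW r1)))).
  by rewrite leeD2l// lee_fin ger0_norm ?subr_ge0// ler_wpM2r ?subr_ge0.
have h2 : J m (pt N i.+1) (h (pt N i.+1)) <= (2 ^- N.+1 * (h m - h (pt N i.+1)))%:E.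
  rewrite -rmE; apply: J_le; rewrite ?(ltW m0) ?(ltW mr) ?(ltW r1)// => z /andP[mz zr].
  have hz1 : (h (pt N i.+1) <= h z)%R by apply: h_ni; rewrite ?(lt_trans m0 mz)// ltW.
  have hz2 : (h z <= h m)%R by apply: h_ni => //; [exact: ltW|exact: lt_trans zr r1].
  by rewrite ger0_norm ?subr_ge0// lerD2r.
have h3 := @tile2 N.+1 i.*2.+1 isT iN1; rewrite -/m -rE in h3.
rewrite addeC ge0_muleDr// [X in _ <= X + _]addeC.
apply: (leeD_halves h2 h1 (le_trans IHx _) h3); rewrite addSnnS leeD2l//.
by rewrite lee_fin ler_wpM2l// ?(ltW (p_gt0 _))// lerD2l lerN2.
Qed.

(** Here the right endpoint may be 1, so h at the right end is replaced in the error term by the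
    lower bound 0. *)
Lemma oscillation_right_approx G N i y : (0 < i)%N -> (i < 2 ^ N)%N ->
  (pt N i < y <= pt N i.+1)%R ->
  J (pt N i) y (h (pt N i)) <= (2 * K)%:E * V (pt N i) y + (2 ^- (N + G) * h (pt N i))%:E.
Proof.
elim: G N i y => [|G IH] N i y i0 iN /andP[iy yi].
  have l0 := @pt_gt0 N _ i0.
  have y1 : (y <= 1)%R by apply: le_trans yi (pt_le1 _).
  rewrite addn0; apply: (@le_trans _ _ ((y - pt N i) * h (pt N i))%:E).
    apply: J_le; rewrite ?(ltW l0) ?(ltW iy)// => z /andP[lz zy].
    have hz : (h z <= h (pt N i))%R by apply: h_ni => //; [exact: ltW|exact: lt_le_trans zy y1].
    by rewrite ler0_norm ?subr_le0// opprB gerBl.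
  rewrite -[leLHS]add0e leeD//; first by rewrite mule_ge0// lee_fin mulr_ge0.
  by rewrite lee_fin ler_wpM2r// lerBlDl -ptS.
set m := pt N.+1 i.*2.+1.
have iN1 : (i.*2.+1 < 2 ^ N.+1)%N by rewrite expnS mul2n ltn_Sdouble.
have i20 : (0 < i.*2)%N by rewrite double_gt0.
have l0 := @pt_gt0 N _ i0.
have lm : (pt N i < m)%R by rewrite /m ptS pt_double ltrDl.
have mlE : (m - pt N i = 2 ^- N.+1)%R by rewrite /m ptS pt_double addrAC subrr add0r.
have m1 : (m < 1)%R by exact: pt_lt1.
have [ym|my] := leP y m.
  have := IH N.+1 i.*2 y i20 (ltn_trans (ltnSn _) iN1).
  by rewrite pt_double -/m iy ym addSnnS; apply.
have IHy := IH N.+1 i.*2.+1 y isT iN1; rewrite -/m in IHy.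
have {IHy} := IHy _; rewrite -doubleS pt_double my yi => /(_ isT) IHy.
have y1 : (y <= 1)%R by apply: le_trans yi (pt_le1 _).
have hm : (h m <= h (pt N i))%R by apply: h_ni => //; exact: ltW.
have yN : (y - m <= 2 ^- N.+1)%R.
  by rewrite lerBlDl (le_trans yi)// -pt_double doubleS [leLHS]ptS.
rewrite (J_split _ (ltW l0) (ltW lm) my y1) (V_split (ltW l0) (ltW lm) my y1).
have h1 : J (pt N i) m (h (pt N i)) <= (2 ^- N.+1 * (h (pt N i) - h m))%:E.
  rewrite -mlE; apply: J_le; rewrite ?(ltW l0) ?(ltW lm) ?(ltW m1)// => z /andP[lz zm].
  have hz1 : (h z <= h (pt N i))%R by apply: h_ni => //; [exact: ltW|exact: lt_trans zm m1].
  have hz2 : (h m <= h z)%R by apply: h_ni; [exact: lt_trans lz|exact: ltW|].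
  by rewrite ler0_norm ?subr_le0// opprB lerD2l lerN2.
have h2 : J m y (h (pt N i)) <= J m y (h m) + (2 ^- N.+1 * (h (pt N i) - h m))%:E.
  have m0 := lt_trans l0 lm.
  apply: (le_trans (J_triangle _ (h m) (ltW m0) (ltW my) y1)).
  by rewrite leeD2l// lee_fin distrC ger0_norm ?subr_ge0// ler_wpM2r ?subr_ge0.
have h3 := @tile2 N.+1 i.*2 i20 iN1; rewrite pt_double -/m in h3.
rewrite ge0_muleDr//; apply: (leeD_halves h1 h2 (le_trans IHy _) h3).
by rewrite addSnnS leeD2l// lee_fin ler_wpM2l// ltW.
Qed.

Let vanishing (A B : \bar R) (z : R) N : (forall G, A <= B + (2 ^- (N + G) * z)%:E) -> A <= B.
Proof.
move=> H; apply/lee_addgt0Pr => e e0.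
have z0 : (0 < `|z| + 1)%R by rewrite ltr_wpDl.
have e20 : (0 < e / (`|z| + 1))%R by rewrite divr_gt0.
have [G /(_ (N + G)%N (leq_addl _ _))] := pow_half_small e20.
rewrite ltr_pdivlMr// => G2.
apply: le_trans (H G) _; rewrite leeD2l// lee_fin (le_trans _ (ltW G2))//.
by rewrite ler_wpM2l ?(ltW (p_gt0 _))// (le_trans (ler_norm _))// lerDl.
Qed.

(** For x > 0 the error vanishes as the depth grows. At x = 0, near which h may be unbounded, the
    estimate follows by monotone convergence along the intervals ]r / (k+2), r[. *)
Lemma oscillation_left N i x : (i.+1 < 2 ^ N)%N -> (pt N i <= x < pt N i.+1)%R ->
  J x (pt N i.+1) (h (pt N i.+1)) <= (2 * K)%:E * V x (pt N i.+1).
Proof.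
move=> iN xi; have r1 := pt_lt1 iN.
have pos y : (0 < y)%R -> (pt N i <= y < pt N i.+1)%R ->
    J y (pt N i.+1) (h (pt N i.+1)) <= (2 * K)%:E * V y (pt N i.+1).
  move=> y0 yi; apply: (@vanishing _ _ (h y - h (pt N i.+1)) N) => G.
  exact: oscillation_left_approx.
have x0 : (0 <= x)%R by apply: le_trans (pt_ge0 N i) _; have /andP[] := xi.
have [/pos|] := ltP 0%R x; first exact.
move=> x0'; have {x0 x0'}xE : x = 0%R by apply/eqP; rewrite eq_le x0 x0'.
move: xi; rewrite xE => /andP[i0 ri].
set r := pt N i.+1 in r1 pos ri *.
pose F (k : nat) : set R := `](r / k.+2%:R)%R, r[%classic.
have k2 (k : nat) : (0 < r / k.+2%:R < r)%R.
  by rewrite divr_gt0//= ltr_pdivrMr// ltr_pMr// ltr1n.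
have FU : \bigcup_k F k = `]0%R, r[%classic.
  apply/seteqP; split => z.
    move=> [k _]; rewrite /F/= !in_itv/= => /andP[kz ->].
    by rewrite (lt_trans _ kz)//; have /andP[] := k2 k.
  rewrite /= in_itv/= => /andP[z0 zr].
  exists (Num.truncn (r / z)) => //; rewrite /F/= in_itv/= zr andbT.
  rewrite ltr_pdivrMr// mulrC -ltr_pdivrMr//.
  by apply: lt_trans (truncnS_gt _) _; rewrite ltr_nat.
rewrite /J -FU.
have cv : \int[leb]_(z in F k) `|h z - h r|%:E @[k --> \oo] -->
    \int[leb]_(z in \bigcup_k F k) `|h z - h r|%:E.
  apply: ge0_nondecreasing_set_cvg_integral => //.
  - apply/nondecreasing_seqP => k; apply/subsetPset => z; rewrite /F/= !in_itv/=.
    move=> /andP[kz ->]; rewrite andbT (le_lt_trans _ kz)// ler_wpM2l ?(ltW ri)//.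
    by rewrite lef_pV2 ?posrE// ler_nat.
  - by move=> k; exact: measurable_itv.
  - move=> k; apply: mhc; first exact: measurable_itv.
    apply: subset_unit_itv; last exact: ltW.
    by have /andP[/ltW] := k2 k.
have Vle k : V (r / k.+2%:R)%R r <= V 0 r.
  apply: le_integral_subset => z.
  - rewrite /= !in_itv/= => /andP[kz ->]; rewrite andbT (lt_trans _ kz)//.
    by have /andP[] := k2 k.
  - by rewrite lee_fin v0/=.
  - by rewrite lee_fin.
rewrite -(cvg_lim _ cv)//; apply: lime_le; first exact: cvgP cv.
apply: nearW => k; have /andP[k0 kr] := k2 k.
apply: (le_trans (pos _ k0 _)); first by rewrite (le_trans i0 (ltW k0)) kr.
by apply: lee_wpmul2l; [rewrite lee_fin mulr_ge0|exact: Vle].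
Qed.

Lemma oscillation_right N i y : (0 < i)%N -> (i < 2 ^ N)%N -> (pt N i < y <= pt N i.+1)%R ->
  J (pt N i) y (h (pt N i)) <= (2 * K)%:E * V (pt N i) y.
Proof.
move=> i0 iN yi; apply: (@vanishing _ _ (h (pt N i)) N) => G.
exact: oscillation_right_approx.
Qed.

(* N is minimal such that a multiple of 2^-N lies in ]x, y[: two consecutive
   multiples cannot both lie there, since one of them would be even. *)
Lemma dyadic_between (x y : R) : (0 <= x)%R -> (x < y)%R -> (y <= 1)%R ->
  exists N j, [/\ (0 < j < 2 ^ N)%N, (pt N j.-1 <= x < pt N j)%R & (pt N j < y <= pt N j.+1)%R].
Proof.
move=> x0 xy y1.
pose B N := `[< exists j, (x < pt N j < y)%R >].
have exB : exists N, B N.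
  have yx : (0 < y - x)%R by rewrite subr_gt0.
  have [N /(_ N (leqnn _)) Nyx] := pow_half_small yx; exists N; apply/asboolP.
  exists (Num.truncn (x * 2 ^+ N)).+1.
  have /truncn_itv/andP[] : (0 <= x * 2 ^+ N)%R by rewrite mulr_ge0// exprn_ge0.
  set k := Num.truncn _ => k1 k2; apply/andP; split.
    by rewrite /pt ltr_pdivlMr// exprn_gt0.
  rewrite ptS; apply: (@le_lt_trans _ _ (x + 2 ^- N)%R); last by rewrite -ltrBrDl.
  by rewrite lerD2r /pt ler_pdivrMr// exprn_gt0.
have [N /asboolP[j /andP[xj jy]] minN] := ex_minnP exB.
have jN : (j < 2 ^ N)%N.
  have := lt_le_trans jy y1.
  by rewrite /pt ltr_pdivrMr ?exprn_gt0// mul1r -natrX ltr_nat.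
have j0 : (0 < j)%N.
  by case: j xj {jy jN} => //; rewrite /pt mul0r ltNge x0.
have noodd i : (x < pt N i < y)%R -> odd i.
  move=> xiy; apply/negPn/negP => ei.
  case: N => [|N] in xj jy minN jN xiy *.
    by move: jN; rewrite expn0 ltnS leqn0 => /eqP j00; rewrite j00 in j0.
  have : B N.
    apply/asboolP; exists i./2; rewrite -pt_double.
    by have := odd_double_half i; rewrite (negbTE ei) add0n => ->.
  by move=> /minN; rewrite ltnn.
have oj : odd j by apply: noodd; rewrite xj.
exists N, j; rewrite j0 jN xj jy/= andbT; split => //.
  rewrite leNgt; apply/negP => xj1.
  have : odd j.-1.
    apply: noodd; rewrite xj1 (lt_trans _ jy)// -{2}(prednK j0) ptS ltrDl.
    exact: p_gt0.
  by move: oj; rewrite -{1}(prednK j0) /= => /negP.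
rewrite leNgt; apply/negP => jy1.
have : odd j.+1 by apply: noodd; rewrite jy1 andbT (lt_trans xj)// ptS ltrDl.
by rewrite /= oj.
Qed.

(** Cut at the coarsest dyadic point inside, each piece lies in one dyadic interval and touches an
    end of it, as the one-sided estimates require. *)
Lemma oscillation_interval (x y : R) : (0 <= x)%R -> (x < y)%R -> (y <= 1)%R ->
  exists m, J x y (h m) <= (2 * K)%:E * V x y.
Proof.
move=> x0 xy y1; have [N [j [/andP[j0 jN] xj jy]]] := dyadic_between x0 xy y1.
have /andP[_ xm] := xj; have /andP[my _] := jy.
exists (pt N j); rewrite (J_split _ x0 (ltW xm) my y1) (V_split x0 (ltW xm) my y1).
rewrite ge0_muleDr//; apply: leeD; last exact: oscillation_right.
by have := @oscillation_left N j.-1 x; rewrite prednK//; apply.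
Qed.

(** Inserting h m between h x and h y bounds the normalized double integral by twice the oscillation
    around h m; this turns 2 K into 4 K. *)
Lemma double_integral_oscillation (Q : set R) : cube1 Q -> Q `<=` unit_itv ->
  (fine (leb Q))^-1%:E * \int[leb]_(x in Q) \int[leb]_(y in Q) `|h x - h y|%:E <=
  (4 * K)%:E * \int[leb]_(x in Q) (v x)%:E.
Proof.
move=> [l [w [b [b' [w0 QE]]]]] Qu.
have lw : (l < l + w)%R by rewrite ltrDl.
have Qsub : (`]l, (l + w)%R[%classic : set R) `<=` Q.
  rewrite QE => z /=; rewrite !in_itv/= => /andP[lz zr].
  by apply/andP; split; [case: (b)|case: (b')] => //=; exact: ltW.
(* Otherwise the midpoint of l and min (l + w) 0 is a negative point of Q. *)
have l0 : (0 <= l)%R.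
  rewrite leNgt; apply/negP => l0.
  have /Qsub/Qu : (`]l, (l + w)%R[%classic : set R) ((l + Num.min (l + w) 0) / 2)%R.
    by rewrite /= in_itv/= minEle; case: ifPn => ?; apply/andP; split; lra.
  rewrite /unit_itv/= in_itv/= minEle; case: ifPn => ?; apply/negP;
    by rewrite negb_and -!leNgt; apply/orP; left; lra.
have r1 : (l + w <= 1)%R.
  rewrite leNgt; apply/negP => r1.
  have /Qsub/Qu : (`]l, (l + w)%R[%classic : set R) ((l + w + Num.max l 1) / 2)%R.
    by rewrite /= in_itv/= maxEle; case: ifPn => ?; apply/andP; split; lra.
  rewrite /unit_itv/= in_itv/= maxEle; case: ifPn => ?; apply/negP;
    by rewrite negb_and -!leNgt; apply/orP; right; lra.
have [m Jm] := oscillation_interval l0 lw r1.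
have mQ : measurable Q by rewrite QE; exact: measurable_itv.
have mhQ c : measurable_fun Q (fun z => `|h z - c|%:E) by exact: mhc.
have ooQ (F : R -> \bar R) : measurable_fun Q F -> \int[leb]_(x in Q) F x = \int[leb]_(x in `]l, (l + w)%R[) F x.
  move=> mF; rewrite QE; apply: integral_itv_bndoo.
  by apply: (measurable_funS mQ).
have lebQ : leb Q = w%:E.
  by rewrite /leb QE lebesgue_measure_itv/= lte_fin lw -EFinB addrAC subrr add0r.
rewrite lebQ/=.
have wi0 : (0 <= w^-1)%R by rewrite invr_ge0 ltW.
pose I := \int[leb]_(x in Q) `|h x - h m|%:E.
have I0 : 0 <= I by apply: integral_ge0 => z _; rewrite lee_fin.
have H1 x : Q x -> \int[leb]_(y in Q) `|h x - h y|%:E <= w%:E * `|h x - h m|%:E + I.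
  move=> Qx.
  apply: (@le_trans _ _ (\int[leb]_(y in Q) (`|h x - h m|%:E + `|h y - h m|%:E))).
    apply: le_integral_subset => // y _; last by rewrite -EFinD lee_fin addr_ge0.
    rewrite -EFinD !lee_fin normr_ge0/= (distrC (h y)).
    by rewrite (_ : (h x - h y = (h x - h m) + (h m - h y))%R) ?ler_normD//; lra.
  rewrite ge0_integralD//; last exact: mhQ.
  rewrite integral_cst// muleC.
  by rewrite [X in X * _ + _ <= _]lebQ.
apply: (@le_trans _ _ (w^-1%:E * (\int[leb]_(x in Q) (w%:E * `|h x - h m|%:E + I)))).
  apply: lee_wpmul2l; first by rewrite lee_fin.
  apply: le_integral_subset => // x Qx.
    by apply/andP; split; [by apply: integral_ge0 => y _; rewrite lee_fin|exact: H1].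
  by rewrite adde_ge0// mule_ge0// lee_fin ltW.
rewrite ge0_integralD//; last 2 first.
- by move=> x _; rewrite mule_ge0// lee_fin ltW.
- by apply: measurable_funeM; exact: mhQ.
rewrite ge0_integralZl_EFin ?(ltW w0)//; last exact: mhQ.
rewrite -/I integral_cst// [X in _ + _ * X]lebQ [X in _ + X]muleC.
rewrite -ge0_muleDr// muleA -EFinM mulVf ?gt_eqF// mul1e.
rewrite (_ : (4 * K)%:E = 2%:E * (2 * K)%:E); last by rewrite -EFinM mulrA; congr (_ * _)%:E; lra.
rewrite -muleA (_ : I + I = 2%:E * I); last first.
  by rewrite -[in LHS](mul1e I) -ge0_muleDl ?lee_fin// -EFinD; congr (_%:E * _); lra.
apply: lee_wpmul2l; first by rewrite lee_fin.
rewrite /I !ooQ//.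
by apply/measurable_EFinP; exact: (measurable_funS measurable_unit_itv Qu mv).
Qed.

End monotone_oscillation.

(** * Transplanting distributions to dyadic intervals *)

Section transplant.
Context {d : measure_display} {T : measurableType d} {R : realType}.
Variables (mu : {sigma_finite_measure set T -> \bar R}) (D : set T) (g : T -> R).
Let leb := @lebesgue_measure R.
Variables (A : nat -> set T) (C : R) (nu : nat -> R).
Variables (l w : nat -> nat -> nat -> R).
Local Open Scope ereal_scope.
Hypotheses (mD : measurable D) (mg : measurable_fun D g)
  (mA : forall k, measurable (A k)) (AD : forall k, A k `<=` D) (tA : trivIset setT A)
  (C4 : (4 <= C)%R) (AC : forall k, mu (A k) <= (C * 2 ^- k.+2)%:E)
  (Anu : forall k, (2^-1 * (2 ^- k.+2 * nu k))%:E <= \int[mu]_(x in A k) `|g x|%:E)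
  (w0 : forall k t i, (i < 2 ^ t)%N -> (0 <= w k t i)%R)
  (wnu : forall k t, (\sum_(i < 2 ^ t) w k t i = nu k)%R).

Let C0 : (0 < C)%R. Proof. exact: lt_le_trans C4. Qed.

Let pE k t : (2 ^- (k + t + 2) = 2 ^- t * 2 ^- k.+2 :> R)%R.
Proof. by rewrite (_ : k + t + 2 = t + k.+2)%N ?exprD ?invfM// !addnS !addn0 addnC. Qed.

Let w_le k t i : (i < 2 ^ t)%N -> (w k t i <= nu k)%R.
Proof.
move=> it; rewrite -(wnu k t) (bigD1 (Ordinal it))//= lerDl sumr_ge0// => j _.
exact: w0.
Qed.

Let nu0 k : (0 <= nu k)%R.
Proof. by rewrite -(wnu k 0) sumr_ge0// => i _; exact: w0. Qed.

Let p k t i : R := (w k t i / nu k * 2 ^- t / C)%R.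

Let p0 k t i : (i < 2 ^ t)%N -> (0 <= p k t i)%R.
Proof.
by move=> it; rewrite /p !mulr_ge0 ?invr_ge0 ?exprn_ge0 ?w0 ?nu0// ltW.
Qed.

Let m k t i (s : R) : \bar R := (p k t i)%:E * tail mu (A k) g s.

Let mgA k : measurable_fun (A k) g.
Proof. exact: (measurable_funS mD (@AD k) mg). Qed.

Let Aoo k : mu (A k) < +oo.
Proof. exact: le_lt_trans (AC k) (ltry _). Qed.

Let tail_le_A k s : tail mu (A k) g s <= mu (A k).
Proof. by apply: le_measure; rewrite ?inE//; exact: measurable_superlevel. Qed.

Let m_ge0 k t i s : (i < 2 ^ t)%N -> 0 <= m k t i s.
Proof. by move=> it; rewrite mule_ge0// ?lee_fin ?p0//; exact: measure_ge0. Qed.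

(** The factor 1 / C in [p] makes the dilated copy fit into its interval, since A k has measure at
    most C 2^-(k+2) and w <= nu. *)
Let m_le k t i s : (i < 2 ^ t)%N -> m k t i s <= (2 ^- (k + t + 2))%:E.
Proof.
move=> it; have pi0 := p0 k it.
apply: (@le_trans _ _ ((p k t i)%:E * (C * 2 ^- k.+2)%:E)).
  apply: lee_wpmul2l; first by rewrite lee_fin.
  exact: le_trans (tail_le_A k s) (AC k).
rewrite -EFinM lee_fin /p.
have -> : (w k t i / nu k * 2 ^- t / C * (C * 2 ^- k.+2) = w k t i / nu k * 2 ^- (k + t + 2))%R.
  rewrite pE; set x : R := (2 ^- t)%R; set y : R := (2 ^- k.+2)%R.
  set z := (w k t i / nu k)%R.
  rewrite (_ : (z * x / C * (C * y) = z * (x * y) * (C / C))%R); last by lra.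
  by rewrite divff ?mulr1// gt_eqF.
rewrite ler_piMl ?invr_ge0 ?exprn_ge0//.
have [->|nuk] := eqVneq (nu k) 0%R; first by rewrite invr0 mulr0.
by rewrite ler_pdivrMr ?mul1r ?w_le// lt_neqAle eq_sym nuk nu0.
Qed.

Let mm k t i : measurable_fun (`[0%R, +oo[%classic : set R) (m k t i).
Proof. by apply: measurable_funeM; exact: measurable_tail. Qed.

Let m_ni k t i : (i < 2 ^ t)%N ->
  {in `[0%R, +oo[ &, {homo m k t i : a b / (a <= b)%R >-> b <= a}}.
Proof.
move=> it a b _ _ ab; apply: lee_wpmul2l; first by rewrite lee_fin p0.
exact: tail_le.
Qed.

Let itv k t i : set R := `]l k t i, (l k t i + 2 ^- (k + t + 2))%R[%classic.

Let u (j : nat) : R -> \bar R := if pickle_inv j is Some (k, t, i) then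
  if (i < 2 ^ t)%N then spread (l k t i) (m k t i) \_ (itv k t i) else cst 0 else cst 0.

Let mu_ j : measurable_fun setT (u j).
Proof.
rewrite /u; case: pickle_inv => // -[[k t] i]; case: ifP => // it.
apply/(measurable_restrictT _ (measurable_itv _)); apply: measurable_funTS.
exact: measurable_spread.
Qed.

Let u_ge0 j x : 0 <= u j x.
Proof.
rewrite /u; case: pickle_inv => // -[[k t] i]; case: ifP => // it.
by apply: erestrict_ge0 => y _; exact: spread_ge0.
Qed.

(* Dilating the distribution of g on A k by p makes the pieces attached to the
   dyadic subintervals of one block sum up to a fixed multiple of the original
   distribution; taking their supremum instead of their sum keeps this bound. *)
Definition transplant (x : R) : \bar R := ereal_sup (range (u ^~ x)).

Lemma measurable_transplant : measurable_fun setT transplant.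
Proof.
have := measurable_fun_esups mu_ 0%N.
by congr measurable_fun; apply/funext => x; rewrite /esups/= /sdrop/=; congr ereal_sup;
  apply/seteqP; split => _ [j _ <-]; exists j.
Qed.

Lemma transplant_ge0 x : 0 <= transplant x.
Proof. by apply: (le_trans (u_ge0 0%N x)); apply: ereal_sup_ubound; exists 0%N. Qed.

(** The transplant dominates its piece (k, t, i), whose integral is p times the integral of |g| over
    A k by the layer cake formula. *)
Lemma integral_transplant_ge k t i : (i < 2 ^ t)%N ->
  (2^-1 / C * (2 ^- (k + t + 2) * w k t i))%:E <=
  \int[leb]_(x in `]l k t i, (l k t i + 2 ^- (k + t + 2))%R[) transplant x.
Proof.
move=> it.
apply: (@le_trans _ _ (\int[leb]_(x in `]l k t i, (l k t i + 2 ^- (k + t + 2))%R[)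
   spread (l k t i) (m k t i) x)); last first.
  apply: le_integral_subset => // x xi; last exact: transplant_ge0.
  rewrite spread_ge0/=; apply: ereal_sup_ubound; exists (pickle (k, t, i)) => //.
  by rewrite /u pickleK_inv it /patch mem_set.
rewrite integral_spread; last 2 first.
- exact: mm.
- by move=> s _; rewrite m_ge0// (_ : (_ - _ = 2 ^- (k + t + 2))%R) ?m_le// addrAC subrr add0r.
rewrite /m ge0_integralZl_EFin ?p0//; last exact: measurable_tail.
rewrite -layer_cake//.
apply: (@le_trans _ _ ((p k t i)%:E * (2^-1 * (2 ^- k.+2 * nu k))%:E)); last first.
  by apply: lee_wpmul2l; rewrite ?lee_fin ?p0.
rewrite -EFinM lee_fin /p.
(* If the total drop on the block is 0, then p is 0 because division by 0 yields 0, and every w on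
   the block vanishes too. *)
have [nuk|nuk] := eqVneq (nu k) 0%R.
  have -> : w k t i = 0%R by apply/eqP; rewrite eq_le w0// andbT -nuk w_le.
  by rewrite !(mulr0, mul0r).
rewrite pE; set x : R := (2 ^- t)%R; set y : R := (2 ^- k.+2)%R; set z := w k t i.
rewrite (_ : (z / nu k * x / C * (2^-1 * (y * nu k)) = 2^-1 / C * (x * y * z) * (nu k / nu k))%R); last by lra.
by rewrite divff// mulr1.
Qed.

Lemma tail_transplant (s : R) : (0 <= s)%R ->
  leb [set x | s%:E < transplant x] <= (2 / C)%:E * tail mu D g s.
Proof.
move=> s0.
pose mf k t i := fine (m k t i s).
have mfE k t i : (i < 2 ^ t)%N -> m k t i s = (mf k t i)%:E.
  move=> it; rewrite fineK// ge0_fin_numE ?m_ge0//.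
  exact: le_lt_trans (m_le k s it) (ltry _).
(* By [spread_gt] the piece (k, t, i) exceeds s at most on this interval, whose length is the
   dilated tail. *)
pose B k t i : set R := `]l k t i, (l k t i + mf k t i)%R[%classic.
have mB k t i : measurable (B k t i) by exact: measurable_itv.
pose B1 k t := \big[setU/set0]_(i < 2 ^ t) B k t i.
pose B2 k := \bigcup_t B1 k t.
have mB1 k t : measurable (B1 k t) by exact: bigsetU_measurable.
have mB2 k : measurable (B2 k) by exact: bigcupT_measurable.
have lebB k t i : (i < 2 ^ t)%N -> leb (B k t i) = m k t i s.
  move=> it; have := m_ge0 k s it; rewrite mfE// lee_fin => mf0.
  rewrite /leb lebesgue_measure_itv/= lte_fin ltrDl; case: ltP => mf0'.
    by rewrite -EFinB addrAC subrr add0r.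
  by congr EFin; apply/eqP; rewrite eq_le mf0 mf0'.
pose tau k := fine (tail mu (A k) g s).
have tauE k : tail mu (A k) g s = (tau k)%:E by rewrite fineK// tail_fin.
have tau0 k : (0 <= tau k)%R by rewrite fine_ge0// measure_ge0.
have lebB1 k t : leb (B1 k t) <= (2 ^- t / C * tau k)%:E.
  apply: (@le_trans _ _ (\sum_(i < 2 ^ t) leb (B k t i))).
    by apply: le_mu_bigsetU => i _; exact: mB.
  rewrite (eq_bigr (fun i : 'I_(2 ^ t) => (p k t i * tau k)%:E)); last first.
    by move=> i _; rewrite lebB// /m tauE.
  rewrite sumEFin lee_fin -mulr_suml ler_wpM2r// /p -!mulr_suml wnu.
  rewrite -mulrA ler_piMl ?mulr_ge0 ?invr_ge0 ?exprn_ge0 ?(ltW C0)//.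
  by have [->|nuk] := eqVneq (nu k) 0%R; rewrite ?mul0r// divff.
have lebB2 k : leb (B2 k) <= (2 / C)%:E * tail mu (A k) g s.
  rewrite tauE -EFinM.
  apply: (@le_trans _ _ (\sum_(t <oo) leb (B1 k t))).
    exact: (@generalized_Boole_inequality _ _ _ (@lebesgue_measure R) (B1 k) (mB1 k) (mB2 k)).
  have c0 : (0 <= 2 / C * tau k)%R by rewrite !mulr_ge0// invr_ge0 ltW.
  apply: le_trans (epsilon_trick0 xpredT c0); apply: lee_nneseries => // t _.
  apply: le_trans (lebB1 k t) _; rewrite lee_fin natrX exprS invfM.
  by set y : R := (2 ^- t)%R; lra.
apply: (@le_trans _ _ (leb (\bigcup_k B2 k))).
  apply: le_measure; rewrite ?inE.
  - rewrite -[X in measurable X]setTI.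
    have := measurable_fun_lte (measurable_cst s%:E) measurable_transplant.
    by move=> /(_ measurableT [set true]); apply.
  - exact: bigcupT_measurable.
  - move=> x /= sx.
    have [j] : exists j, s%:E < u j x.
      apply: contrapT => /forallNP nj; move: sx; rewrite ltNge => /negP; apply.
      by apply: ub_ereal_sup => _ [j _ <-]; rewrite leNgt; apply/negP; exact: nj.
    rewrite /u; case: pickle_inv => [[[k t] i]|]/=; last by rewrite lte_fin ltNge s0.
    case: ifPn => it/=; last by rewrite lte_fin ltNge s0.
    rewrite /patch; case: ifPn => [/set_mem xi|_]; last by rewrite lte_fin ltNge s0.
    move=> /(spread_gt (mm k t i) (m_ni k it) s0); rewrite mfE// lte_fin => xm.
    exists k => //; exists t => //; rewrite /B1 -bigcup_mkord; exists i => //.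
    by move: xi; rewrite /itv /B/= !in_itv/= => /andP[-> _]/=; rewrite -ltrBlDl.
apply: (@le_trans _ _ (\sum_(k <oo) leb (B2 k))).
  by apply: generalized_Boole_inequality => //; exact: bigcupT_measurable.
apply: (@le_trans _ _ (\sum_(k <oo) ((2 / C)%:E * tail mu (A k) g s))).
  by apply: lee_nneseries.
rewrite nneseriesZl; last by move=> k _; exact: measure_ge0.
apply: lee_wpmul2l; first by rewrite lee_fin divr_ge0// ltW.
rewrite /tail -measure_semi_bigcup.
- apply: le_measure; rewrite ?inE.
  + by apply: bigcupT_measurable => k; exact: measurable_superlevel.
  + exact: measurable_superlevel.
  + by move=> x [k _ [/AD Dx gx]].
- by move=> k; exact: measurable_superlevel.
- by apply: trivIset_setIr.
- by apply: bigcupT_measurable => k; exact: measurable_superlevel.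
Qed.

Lemma transplant_exists : exists v : R -> \bar R,
  [/\ measurable_fun setT v, forall x, 0 <= v x,
    forall k t i, (i < 2 ^ t)%N -> (2^-1 / C * (2 ^- (k + t + 2) * w k t i))%:E <=
      \int[leb]_(x in `]l k t i, (l k t i + 2 ^- (k + t + 2))%R[) v x &
    forall s, (0 <= s)%R -> leb [set x | s%:E < v x] <= (2^-1)%:E * tail mu D g s].
Proof.
exists transplant; split.
- exact: measurable_transplant.
- exact: transplant_ge0.
- by move=> k t i; exact: integral_transplant_ge.
- move=> s s0; apply: le_trans (tail_transplant s0) _.
  apply: lee_wpmul2r; first exact: measure_ge0.
  by rewrite lee_fin ler_pdivrMr//; move: C4; lra.
Qed.

End transplant.

(** * Rearrangements and the Garsia-Rodemich condition *)

Section rearrangement_levels.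
Context {d : measure_display} {T : measurableType d} {R : realType}.
Variables (mu : {sigma_finite_measure set T -> \bar R}) (D : set T) (g : T -> R).
Hypotheses (mD : measurable D) (Doo : (mu D < +oo)%E) (mg : measurable_fun D g).
Local Open Scope ereal_scope.

Lemma tail_rearr_le (t : R) : (0 < t)%R -> tail mu D g (rearr mu D g t) <= t%:E.
Proof.
by move=> t0; rewrite leNgt -(rearr_gt mD Doo mg t0) ?ltxx// rearr_ge0.
Qed.

Lemma measurable_ge_level (s : R) : measurable (D `&` [set x | (s <= `|g x|)%R]).
Proof.
have mgn : measurable_fun D (fun x => `|g x|)%R by exact: measurableT_comp.
by have /(_ mD [set true]) := measurable_fun_ler (measurable_cst s) mgn; apply.
Qed.

Lemma rearr_level_ge (t : R) : (0 < t)%R -> t%:E <= mu D ->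
  t%:E <= mu (D `&` [set x | (rearr mu D g t <= `|g x|)%R]).
Proof.
move=> t0 tD; set r := rearr mu D g t.
have := rearr_ge0 mu D g t; rewrite -/r le_eqVlt => /predU1P[r0|r0].
  rewrite (_ : _ `&` _ = D)//; apply/seteqP; split => [x []//|x Dx]; split => //=.
  by rewrite -r0.
pose s (k : nat) := (r - r / k.+1%:R)%R.
have s0 k : (0 <= s k)%R by rewrite subr_ge0 ler_pdivrMr// ler_peMr ?(ltW r0)// ler1n.
have sr k : (s k < r)%R by rewrite gtrBl divr_gt0.
have sS k l : (k <= l)%N -> (s k <= s l)%R.
  by move=> kl; rewrite lerD2l lerN2 ler_wpM2l ?(ltW r0)// lef_pV2 ?posrE// ler_nat.
have ts k : t%:E <= tail mu D g (s k).
  by apply: ltW; rewrite -(rearr_gt mD Doo mg t0).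
have : tail mu D g (s k) @[k --> \oo] --> mu (\bigcap_k (D `&` [set x | (s k < `|g x|)%R])).
  apply: nonincreasing_cvg_mu.
  - apply: le_lt_trans Doo; apply: le_measure; rewrite ?inE//.
    exact: measurable_superlevel.
  - by move=> k; exact: measurable_superlevel.
  - by apply: bigcapT_measurable => k; exact: measurable_superlevel.
  - apply/nonincreasing_seqP => k; apply/subsetPset => x [Dx /= sx]; split => //=.
    by apply: le_lt_trans sx; exact: sS.
rewrite (_ : \bigcap_k _ = D `&` [set x | (r <= `|g x|)%R]); last first.
  apply/seteqP; split => [x H|x [Dx /= rx] k _]; last first.
    by split => //=; exact: lt_le_trans rx.
  split; first by have [] := H 0%N I.
  rewrite /= leNgt; apply/negP => gr.
  have : (0 < (r - `|g x|) / r)%R by rewrite divr_gt0// subr_gt0.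
  move=> /ltr_add_invr[k]; rewrite add0r ltr_pdivlMr// mulrC => kr.
  by have [_ /=] := H k I; apply/negP; rewrite -leNgt /s lerBrDr -lerBrDl ltW.
move=> cv; rewrite -(cvg_lim _ cv)//; apply: lime_ge; first exact: cvgP cv.
exact: nearW.
Qed.

End rearrangement_levels.

Lemma sumr_telescope {R : realType} (u : nat -> R) m n :
  \sum_(i < n) (u (m + i)%N - u (m + i).+1) = u m - u (m + n)%N.
Proof.
elim: n => [|n IH]; first by rewrite big_ord0 addn0 subrr.
by rewrite big_ord_recr/= IH addnS; lra.
Qed.

Lemma unit_cube_frame {R : realType} n (Q0 : set (n.-tuple R)) :
  (0 < n)%N -> cube Q0 -> lebesgue_tuple n Q0 = 1%E ->
  exists a : n.-tuple R, [/\ measurable Q0, lebesgue_tuple n (Q0 `\` unit_box a) = 0%E &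
    forall N i, valid N i -> ocube a N i `<=` Q0].
Proof.
move=> n0 [a [w [b [b' [w0 QE]]]]] Q1; exists a.
have mA j : measurable [set` Interval (BSide (b j) (tnth a j)) (BSide (b' j) (tnth a j + w))].
  exact: measurable_itv.
have mQ : measurable Q0.
  rewrite QE (_ : [set x | _] = \bigcap_(j in [set: 'I_n])
    ([set: n.-tuple R] `&` (fun x : n.-tuple R => tnth x j) @^-1`
     [set` Interval (BSide (b j) (tnth a j)) (BSide (b' j) (tnth a j + w))])).
    by apply: fin_bigcap_measurable => // j _; apply: (@measurable_tnth _ R n j).
  by apply/seteqP; split => x /= H j => [_|]; [split => //; exact: H | case: (H j I)].
have w1 : w = 1.
  have := lebesgue_tuple_box mA; rewrite (_ : [set x | _] = Q0); last by rewrite QE.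
  rewrite Q1 (eq_bigr (fun=> w%:E)) => [|j _]; last first.
    by rewrite lebesgue_measure_itv/= lte_fin ltrDl w0 -EFinB addrAC subrr add0r.
  rewrite prode_const => -[/esym/eqP].
  by rewrite pexpr_eq1 ?(ltW w0)//= => /eqP.
have oQ N i : valid N i -> ocube a N i `<=` Q0.
  move=> vi x xi; have xu := hcube_unit_box vi (ocube_hcube xi).
  rewrite QE w1 => j; have := xi j; have := xu j; rewrite !in_itv/= => /andP[_ x1].
  rewrite tnth_mktuple => /andP[ax _]; apply/andP; split.
    have ajx : tnth a j < tnth x j.
      by apply: le_lt_trans ax; rewrite lerDl mulr_ge0// invr_ge0 exprn_ge0.
    by case: (b j) => //=; exact: ltW.
  by case: (b' j) => //=; exact: ltW.
split => //.
have v0 : valid 0 [tuple 0%N | j < n] by move=> j; rewrite tnth_mktuple.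
have mO := @measurable_ocube R n a 0 [tuple 0%N | j < n].
have OQ := oQ _ _ v0; set O := ocube a 0 _ in mO OQ.
have O1 : lebesgue_tuple n O = 1%E.
  by have := lebesgue_dyadic_box a false true 0 [tuple 0%N | j < n]; rewrite expr0 invr1 expr1n.
have QO : lebesgue_tuple n (Q0 `\` O) = 0%E.
  have : lebesgue_tuple n Q0 = (lebesgue_tuple n (Q0 `\` O) + lebesgue_tuple n (Q0 `&` O))%E.
    exact: measureDI.
  rewrite (setIidr OQ) O1 Q1; case: (lebesgue_tuple n (Q0 `\` O)) => [r| |]//= [].
  by move=> /eqP; rewrite addrC -subr_eq0 opprD addrA subrr sub0r oppr_eq0 => /eqP ->.
apply: (@subset_measure0 _ _ _ _ _ (Q0 `\` O)) => //.
- by apply: measurableD => //; exact: measurable_unit_box.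
- exact: measurableD.
- by move=> x [Qx nu]; split => // /ocube_hcube; rewrite -unit_boxE.
Qed.

Lemma dyadic_block N i : (0 < i)%N -> (i.+1.*2 <= 2 ^ N)%N -> exists k t i',
  [/\ (i' < 2 ^ t)%N, N = (k + t + 2)%N & i = (2 ^ t + i')%N].
Proof.
move=> i0 iN; have /andP[ti it] := trunc_log_bounds (isT : (1 < 2)%N) i0.
set t := trunc_log 2 i in ti it.
have tN : (t + 2 <= N)%N.
  rewrite addn2 -(@ltn_exp2l 2)// expnS mul2n.
  apply: leq_ltn_trans (_ : i.*2 < _)%N; first by rewrite leq_double.
  by apply: leq_trans iN; rewrite ltn_double.
exists (N - (t + 2))%N, t, (i - 2 ^ t)%N; split.
- by rewrite ltn_subLR// addnn -mul2n -expnS.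
- by rewrite -addnA subnK.
- by rewrite subnKC.
Qed.

Section garsia_rodemich_rearrangement.
Context {R : realType}.
Variables (n : nat) (Q0 : set (n.-tuple R)) (f g : n.-tuple R -> R).
Let mu := @lebesgue_tuple R n.
Let leb := @lebesgue_measure R.
Hypotheses (n_gt0 : (0 < n)%N) (cQ0 : cube Q0) (Q01 : mu Q0 = 1%E)
  (intf : mu.-integrable Q0 (EFin \o f))
  (fg : Gamma mu (@cube R n) (@interior_tuple R n) Q0 f g).
Let h := rearr mu Q0 f.
Local Open Scope ereal_scope.

Let frame := unit_cube_frame n_gt0 cQ0 Q01.

Let mQ0 : measurable Q0. Proof. by have [a []] := frame. Qed.
Let Q0oo : mu Q0 < +oo. Proof. by rewrite Q01 ltry. Qed.
Let mf : measurable_fun Q0 f.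
Proof. by have /measurable_int/measurable_EFinP := intf. Qed.
Let mg : measurable_fun Q0 g. Proof. exact: measurable_Gamma fg. Qed.

Let h_ni (s t : R) : (0 < s)%R -> (s <= t)%R -> (h t <= h s)%R.
Proof. exact: rearr_le. Qed.

Let pw N : (0 < 2 ^- N :> R)%R. Proof. by rewrite invr_gt0 exprn_gt0. Qed.
Let pwS N : (2 ^- N = 2 * 2 ^- N.+1 :> R)%R.
Proof. by rewrite exprS invfM mulrA divff ?mul1r// pnatr_eq0. Qed.
Let pwle N : (2 ^- N.+1 <= 2^-1 :> R)%R.
Proof. by rewrite exprS invfM ler_piMr// invf_le1 ?exprn_ege1 ?exprn_gt0// ler1n. Qed.

Let pow_block k t : ((2 ^ t)%N%:R * 2 ^- (k + t + 2) = 2 ^- k.+2 :> R)%R.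
Proof.
rewrite natrX (_ : k + t + 2 = t + k.+2)%N; last by rewrite !addnS !addn0 addnC.
by rewrite exprD invfM mulrA divff ?mul1r// expf_neq0// pnatr_eq0.
Qed.

Let pow_block2 k t : ((2 ^ t + 2 ^ t)%N%:R * 2 ^- (k + t + 2) = 2 ^- k.+1 :> R)%R.
Proof. by rewrite natrD mulrDl pow_block (pwS k.+1); lra. Qed.

Let C : R := (2 ^+ n.+2)%R.
Let C4 : (4 <= C)%R.
Proof.
by rewrite /C !exprS mulrA (_ : (2 * 2 = 4 :> R)%R) ?ler_peMr ?exprn_ege1 ?ler1n//; lra.
Qed.

Let CE k : (2 ^+ n.+1 * 2 ^- k.+1 = C * 2 ^- k.+2 :> R)%R.
Proof. by rewrite (pwS k.+1) /C [(2 ^+ n.+2)%R]exprS; lra. Qed.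

Let level_tail (t : R) : (0 < t)%R -> mu (Q0 `&` [set x | (h t < `|f x|)%R]) <= t%:E.
Proof. by move=> t0; exact: tail_rearr_le. Qed.

Let level_ge (t : R) : (0 < t <= 1)%R -> t%:E <= mu (Q0 `&` [set x | (h t <= `|f x|)%R]).
Proof. by move=> /andP[t0 t1]; apply: rearr_level_ge; rewrite // Q01 lee_fin. Qed.

Let muC (A B : set (n.-tuple R)) : measurable A -> A `<=` Q0 -> Q0 `\` A = B ->
  mu B = 1 - mu A.
Proof.
move=> mA AQ <-.
have : mu Q0 = mu (Q0 `\` A) + mu (Q0 `&` A) by exact: measureDI.
rewrite (setIidr AQ) Q01.
have : mu A \is a fin_num.
  rewrite ge0_fin_numE ?measure_ge0//; apply: le_lt_trans Q0oo.
  by apply: le_measure; rewrite ?inE.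
by move=> Afin ->; rewrite addeK.
Qed.

Let v0_exists : exists v : R -> \bar R,
  [/\ measurable_fun setT v, forall x, 0 <= v x,
    forall k t i, (i < 2 ^ t)%N -> let N := (k + t + 2)%N in let j := (2 ^ t + i)%N in
      (2^-1 / C * (2 ^- N * (h (j%:R * 2 ^- N) - h (j.+1%:R * 2 ^- N))))%:E <=
      \int[leb]_(x in `](j%:R * 2 ^- N)%R, (j%:R * 2 ^- N + 2 ^- N)%R[) v x &
    forall s, (0 <= s)%R -> leb [set x | s%:E < v x] <= (2^-1)%:E * tail mu Q0 g s].
Proof.
have [a [_ Q0u Q0cube]] := frame.
pose c k := h (2 ^- k.+1)%R.
have iG : mu.-integrable Q0 (EFin \o (fun x => `|f x|)%R).
  by have := integrable_abse intf; apply: eq_integrable.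
have c_nd k : (c k <= c k.+1)%R by apply: h_ni => //; rewrite (pwS k.+1) ler_peMl// ?ltW// ltr1n.
have Gc k : mu (Q0 `&` [set x | (c k < `|f x|)%R]) <= (2 ^- k.+1)%:E by exact: level_tail.
have cG k : (2 ^- k.+2)%:E <= mu (Q0 `&` [set x | (c k.+1 <= `|f x|)%R]).
  by apply: level_ge; rewrite pw/= (le_trans (pwle _))// invf_le1// ler1n.
have [A [mA AQ tA muA intA]] := level_allocation n_gt0 mQ0 Q01 Q0u Q0cube fg iG
  (fun x y _ _ => ler_dist_dist _ _) c_nd Gc cG.
pose H k t j := h (j%:R * 2 ^- (k + t + 2))%R.
pose w k t i := (H k t (2 ^ t + i)%N - H k t (2 ^ t + i).+1)%R.
have w0 k t i : (i < 2 ^ t)%N -> (0 <= w k t i)%R.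
  move=> _; rewrite subr_ge0; apply: h_ni.
    by rewrite mulr_gt0// ltr0n addn_gt0 expn_gt0.
  by rewrite ler_wpM2r ?(ltW (pw _))// ler_nat.
have wnu k t : (\sum_(i < 2 ^ t) w k t i = c k.+1 - c k)%R.
  by rewrite (sumr_telescope (H k t)) /H pow_block pow_block2.
have muA' k : mu (A k) <= (C * 2 ^- k.+2)%:E by rewrite -CE.
exact: (transplant_exists (fun k t i => ((2 ^ t + i)%:R * 2 ^- (k + t + 2))%R) mQ0 mg
  mA AQ tA C4 muA' intA w0 wnu).
Qed.

Let v1_exists : exists v : R -> \bar R,
  [/\ measurable_fun setT v, forall x, 0 <= v x,
    forall k t i, (i < 2 ^ t)%N -> let N := (k + t + 2)%N in let j := (2 ^ t + i)%N in
      (2^-1 / C * (2 ^- N * (h (1 - j.+1%:R * 2 ^- N) - h (1 - j%:R * 2 ^- N))))%:E <=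
      \int[leb]_(x in `](1 - j.+1%:R * 2 ^- N)%R, (1 - j.+1%:R * 2 ^- N + 2 ^- N)%R[) v x &
    forall s, (0 <= s)%R -> leb [set x | s%:E < v x] <= (2^-1)%:E * tail mu Q0 g s].
Proof.
have [a [_ Q0u Q0cube]] := frame.
pose c k := (- h (1 - 2 ^- k.+1))%R.
have iG : mu.-integrable Q0 (EFin \o (fun x => - `|f x|)%R).
  by have := integrableN (integrable_abse intf); apply: eq_integrable.
have Gf x y : Q0 x -> Q0 y -> (`|- `|f x| - (- `|f y|)| <= `|f x - f y|)%R.
  by move=> _ _; rewrite -opprD normrN ler_dist_dist.
have t01 k : (0 < 1 - (2 ^- k.+1 : R) <= 1)%R.
  rewrite subr_gt0 gerBl (ltW (pw _)) andbT (le_lt_trans (pwle _))//.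
  by rewrite invf_lt1// ltr1n.
have c_nd k : (c k <= c k.+1)%R.
  rewrite lerN2; apply: h_ni; first by have /andP[] := t01 k.
  by rewrite lerD2l lerN2 (pwS k.+1) ler_peMl// ?ltW// ltr1n.
have Gc k : mu (Q0 `&` [set x | (c k < - `|f x|)%R]) <= (2 ^- k.+1)%:E.
  have m1 := measurable_ge_level mQ0 mf (h (1 - 2 ^- k.+1)).
  rewrite (muC m1); last 2 first.
  - by move=> x [].
  - apply/seteqP; split => x /=; rewrite /c ltrN2.
      by move=> [Qx nx]; split => //; rewrite ltNge; apply/negP => ?; apply: nx.
    by move=> [Qx fx]; split => // -[_]; rewrite leNgt fx.
  have := level_ge (t01 k).
  have : mu (Q0 `&` [set x | (h (1 - 2 ^- k.+1) <= `|f x|)%R]) \is a fin_num.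
    rewrite ge0_fin_numE ?measure_ge0//; apply: le_lt_trans Q0oo.
    by apply: le_measure; rewrite ?inE.
  by move=> /fineK <-; rewrite -EFinB !lee_fin => ?; lra.
have cG k : (2 ^- k.+2)%:E <= mu (Q0 `&` [set x | (c k.+1 <= - `|f x|)%R]).
  have m1 := measurable_superlevel mQ0 mf (h (1 - 2 ^- k.+2)).
  rewrite (muC m1); last 2 first.
  - by move=> x [].
  - apply/seteqP; split => x /=; rewrite /c lerN2.
      by move=> [Qx nx]; split => //; rewrite leNgt; apply/negP => ?; apply: nx.
    by move=> [Qx fx]; split => // -[_]; rewrite ltNge fx.
  have /andP[t0 _] := t01 k.+1; have := level_tail t0.
  have : mu (Q0 `&` [set x | (h (1 - 2 ^- k.+2) < `|f x|)%R]) \is a fin_num.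
    rewrite ge0_fin_numE ?measure_ge0//; apply: le_lt_trans Q0oo.
    by apply: le_measure; rewrite ?inE.
  by move=> /fineK <-; rewrite -EFinB !lee_fin => ?; lra.
have [A [mA AQ tA muA intA]] := level_allocation n_gt0 mQ0 Q01 Q0u Q0cube fg iG Gf c_nd Gc cG.
pose H k t j := (- h (1 - j%:R * 2 ^- (k + t + 2)))%R.
pose w k t i := (H k t (2 ^ t + i)%N - H k t (2 ^ t + i).+1)%R.
have w0 k t i : (i < 2 ^ t)%N -> (0 <= w k t i)%R.
  move=> it; rewrite subr_ge0 lerN2; apply: h_ni.
    rewrite subr_gt0 (le_lt_trans (_ : _ <= 2 ^- k.+1)%R)//; last by have /andP[] := t01 k; rewrite subr_gt0.
    rewrite -(pow_block2 k t) ler_wpM2r ?(ltW (pw _))// ler_nat.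
    by rewrite -addnS leq_add2l.
  by rewrite lerD2l lerN2 ler_wpM2r ?(ltW (pw _))// ler_nat.
have wnu k t : (\sum_(i < 2 ^ t) w k t i = c k.+1 - c k)%R.
  by rewrite (sumr_telescope (H k t)) /H pow_block pow_block2.
have muA' k : mu (A k) <= (C * 2 ^- k.+2)%:E by rewrite -CE.
have [v [mv v0 vint vtail]] := transplant_exists (fun k t i => (1 - (2 ^ t + i).+1%:R * 2 ^- (k + t + 2))%R) mQ0 mg
  mA AQ tA C4 muA' intA w0 wnu.
exists v; split => // k t i it /=; apply: le_trans (vint k t i it).
by rewrite lee_fin /w /H !opprK ler_pM2l ?mulr_gt0 ?invr_gt0 ?(lt_le_trans _ C4)// ler_pM2l//; lra.
Qed.

Lemma garsia_rodemich_rearrangement : exists v : R -> R,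
  [/\ measurable_fun (@unit_itv R) v, forall x, (0 <= v x)%R,
    forall s, (0 <= s)%R -> tail (@lebesgue_measure R) unit_itv v s <= tail mu Q0 g s &
    forall Q : set R, cube1 Q -> Q `<=` unit_itv ->
      (fine (leb Q))^-1%:E * \int[leb]_(x in Q) \int[leb]_(y in Q) `|h x - h y|%:E <=
      (2 ^+ n.+4.+1)%:E * \int[leb]_(x in Q) (v x)%:E].
Proof.
have [u [mu_ u0 uint utail]] := v0_exists.
have [u' [mu'_ u'0 u'int u'tail]] := v1_exists.
pose ve x := maxe (u x) (u' x).
have mve : measurable_fun setT ve by exact: measurable_maxe.
have ve0 x : 0 <= ve x by rewrite le_max u0.
pose v x := fine (ve x).
have mv : measurable_fun setT v by exact: measurableT_comp.
have mS (F : R -> \bar R) (s : R) : measurable_fun setT F -> measurable [set x | s%:E < F x].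
  move=> mF; rewrite -[X in measurable X]setTI.
  by have /(_ measurableT [set true]) := measurable_fun_lte (measurable_cst s%:E) mF; apply.
have tail_ve s : (0 <= s)%R -> leb [set x | s%:E < ve x] <= tail mu Q0 g s.
  move=> s0; apply: (@le_trans _ _ (leb ([set x | s%:E < u x] `|` [set x | s%:E < u' x]))).
    apply: le_measure; rewrite ?inE; first exact: mS.
    - by apply: measurableU; exact: mS.
    - by move=> x /=; rewrite lt_max => /orP[]; [left|right].
  apply: (le_trans (measureU2 _ _ _)); [exact: mS|exact: mS|].
  apply: (le_trans (leeD (utail _ s0) (u'tail _ s0))).
  rewrite -ge0_muleDl ?lee_fin// -EFinD (_ : (2^-1 + 2^-1 = 1 :> R)%R) ?mul1e//; lra.
have ve_fin : leb [set x | ve x = +oo] = 0.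
  have mI : measurable [set x | ve x = +oo].
    rewrite (_ : [set x | _] = setT `&` ve @^-1` [set +oo]); last by rewrite setTI.
    by apply: mve => //; exact: emeasurable_set1.
  apply/eqP; rewrite eq_le measure_ge0 andbT; apply/lee_addgt0Pr => e e0; rewrite add0e.
  have := tail_cvg0 mQ0 Q0oo mg => /fine_cvgP[_ /cvgr_lt/(_ _ e0)[k _ /(_ k (leqnn _))/= ke]].
  apply: (@le_trans _ _ (tail mu Q0 g k%:R)); last first.
    by rewrite -[leLHS]fineK ?lee_fin ?ltW// tail_fin.
  apply: le_trans (tail_ve k%:R (ler0n _ _)); apply: le_measure; rewrite ?inE//; first exact: mS.
  by move=> x /= ->; rewrite ltry.
have intv (x y : R) : \int[leb]_(z in `]x, y[) (v z)%:E = \int[leb]_(z in `]x, y[) ve z.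
  apply: ge0_ae_eq_integral => //.
  - by apply/measurable_EFinP; exact: measurable_funTS.
  - exact: measurable_funTS.
  - by move=> z _; rewrite lee_fin fine_ge0.
  - exists [set z | ve z = +oo]; split => //.
      rewrite (_ : [set x | _] = setT `&` ve @^-1` [set +oo]); last by rewrite setTI.
      by apply: mve => //; exact: emeasurable_set1.
    move=> z /=; apply: contra_notP => /eqP vz _.
    by rewrite fineK// ge0_fin_numE// lt_neqAle vz leey.
have C0 : (0 < C)%R by exact: lt_le_trans C4.
have scale (F : R -> \bar R) (x y r : R) : (forall z, 0 <= F z) -> (forall z, F z <= ve z) ->
    (2^-1 / C * r)%:E <= \int[leb]_(z in `]x, y[) F z ->
    r%:E <= (2 * C)%:E * \int[leb]_(z in `]x, y[) (v z)%:E.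
  move=> F0 Fve H; rewrite intv.
  rewrite (_ : r = (2 * C) * (2^-1 / C * r))%R; last first.
    rewrite (_ : (2 * C * (2^-1 / C * r) = r * (C / C))%R); last by lra.
    by rewrite divff ?mulr1// gt_eqF.
  rewrite EFinM; apply: lee_wpmul2l; first by rewrite lee_fin mulr_ge0// ltW.
  apply: le_trans H _; apply: le_integral_subset => // z _.
  by rewrite F0 Fve.
exists v; split.
- exact: measurable_funTS.
- by move=> x; rewrite fine_ge0.
- move=> s s0; apply: le_trans (tail_ve s s0); apply: le_measure; rewrite ?inE.
  + apply: measurable_superlevel; first exact: measurable_unit_itv.
    exact: measurable_funTS.
  + exact: mS.
  + move=> x [_ /=]; rewrite ger0_norm ?fine_ge0// /v.
    by case: (ve x) (ve0 x) => [r| |]//=; rewrite ltry.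
- move=> Q cQ Qu.
  have -> : (2 ^+ n.+4.+1 = 4 * (2 * C) :> R)%R by rewrite /C !exprS; lra.
  apply: double_integral_oscillation => //.
  + by apply: measurable_rearr => //; [exact: measurable_unit_itv|exact: unit_itv_gt0].
  + by move=> s t s0 st _; exact: h_ni.
  + by move=> s; exact: rearr_ge0.
  + exact: measurable_funTS.
  + by move=> s; rewrite fine_ge0.
  + by rewrite mulr_ge0// ltW.
  move=> N i i0 iN /=.
  have eS : (i%:R * 2 ^- N + 2 ^- N = i.+1%:R * 2 ^- N :> R)%R.
    by rewrite -[in RHS]natr1 mulrDl mul1r.
  have [iN2|iN2] := leqP i.+1.*2 (2 ^ N).
    have [k [t [i' [i't NE iE]]]] := dyadic_block i0 iN2.
    apply: (scale u) => //; first by move=> z; rewrite le_max lexx.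
    have := uint k t i' i't; rewrite /= -NE -iE.
    by rewrite eS.
  pose j := (2 ^ N - i.+1)%N.
  have j0 : (0 < j)%N by rewrite subn_gt0.
  have jS : j.+1 = (2 ^ N - i)%N by rewrite /j subnS prednK// subn_gt0 ltnW.
  have iN3 : (2 ^ N <= i.*2)%N.
    by case: N iN iN2 {eS j j0 jS} => [|N']//; rewrite expnS mul2n ltn_double ltnS leq_double.
  have jN : (j.+1.*2 <= 2 ^ N)%N by rewrite jS doubleB leq_subLR -addnn leq_add2r.
  have [k [t [i' [i't NE jE]]]] := dyadic_block j0 jN.
  have NN : (2 ^+ N * 2 ^- N = 1 :> R)%R by rewrite divff// expf_neq0// pnatr_eq0.
  have e1 : (1 - j.+1%:R * 2 ^- N = i%:R * 2 ^- N :> R)%R.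
    by rewrite jS natrB ?(ltnW (ltnW iN))// natrX mulrBl NN; lra.
  have e2 : (1 - j%:R * 2 ^- N = i.+1%:R * 2 ^- N :> R)%R.
    by rewrite natrB ?(ltnW iN)// natrX mulrBl NN; lra.
  apply: (scale u') => //; first by move=> z; rewrite le_max lexx orbT.
  have := u'int k t i' i't; rewrite /= -NE -jE e1 e2.
  by rewrite eS.
Qed.

End garsia_rodemich_rearrangement.

Theorem theorem4 (R : realType) (n : nat) (n_gt0 : (0 < n)%N) :
  exists c : R, 0 < c /\
    forall Q0 : set (n.-tuple R), cube Q0 -> lebesgue_tuple n Q0 = 1%E ->
    forall (X : ri_space (lebesgue_tuple n) Q0)
           (Xbar : ri_space (@lebesgue_measure R) unit_itv),
      representation_space X Xbar ->
    forall f : n.-tuple R -> R, GaRoQ Q0 X f ->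
      (GaRo_norm01 Xbar (rearr (lebesgue_tuple n) Q0 f)
         <= c%:E * GaRo_normQ Q0 X f)%E.
Proof.
exists (2 ^+ n.+4.+1); set c : R := 2 ^+ n.+4.+1.
have c0 : 0 < c by rewrite exprn_gt0.
split => // Q0 cQ0 Q01 X Xbar XX f [intf _].
rewrite -lee_pdivrMl//; apply: le_ereal_inf_tmp => _ [g fg <-].
rewrite lee_pdivrMl//.
have [Xg|] := ltP (X g) +oo%E; last first.
  by rewrite leye_eq => /eqP ->; rewrite gt0_muley ?leey// lte_fin.
have [a [mQ0 _ _]] := unit_cube_frame n_gt0 cQ0 Q01.
have mg := measurable_Gamma fg.
have [v [mv v0 vtail vosc]] := garsia_rodemich_rearrangement n_gt0 cQ0 Q01 intf fg.
have XE := XX g mg.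
have Xv : (Xbar v <= X g)%E.
  rewrite XE; apply: ri_norm_le_tail => //; first by rewrite Q01.
  by rewrite -XE.
have Xvoo : (Xbar v < +oo)%E by exact: le_lt_trans Xg.
apply: (@le_trans _ _ (Xbar (fun x => c * v x))); last first.
  rewrite (bfnZ (ri_banach Xbar))// gtr0_norm//.
  by apply: lee_wpmul2l => //; rewrite lee_fin ltW.
apply: ereal_inf_lbound; exists (fun x => c * v x) => //; split.
  have iv : (@lebesgue_measure R).-integrable unit_itv (EFin \o v).
    apply/integrableP; split; first exact/measurable_EFinP.
    have [C HC] := ri_L1 Xbar; apply: le_lt_trans (HC v Xvoo) _.
    have : (0 <= Xbar v)%E by exact: (bfn_ge0 (ri_banach Xbar)).
    by case: (Xbar v) Xvoo => [r| |]// _ _; rewrite -EFinM ltry.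
  have mU : measurable (@unit_itv R : set (measurableTypeR R)) by exact: measurable_itv.
  by have := integrableZl mU c iv; exact: eq_integrable.
move=> P Q [PQ _]; apply: lee_nneseries => [k _ Pk|k Pk].
  apply: mule_ge0; first by rewrite lee_fin invr_ge0 fine_ge0// measure_ge0.
  by apply: integral_ge0 => x _; apply: integral_ge0 => y _; rewrite lee_fin.
have [cQ Qu] := PQ k Pk.
apply: le_trans (vosc _ cQ Qu) _.
have mQ : measurable (Q k) by have [l [w [b [b' [_ ->]]]]] := cQ; exact: measurable_itv.
rewrite -ge0_integralZl_EFin//.
- by move=> x _; rewrite lee_fin.
- by apply/measurable_EFinP; exact: (measurable_funS measurable_unit_itv Qu mv).
Qed.
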